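(* Let $(\mathcal S,d,\mu)$ be a space of homogeneous type with quasimetric constant $\kappa$ and doubling order $D_\mu$. Let $1<p<\infty$, let $w\in A_p$, let $p'$ be the dual exponent of $p$ ($\frac1p+\frac1{p'}=1$), and let $\sigma=w^{1-p'}$. For a weight $v$ put $r(v)=1+\frac1{\tau_{\kappa\mu}[v]_{A_\infty}}$, where $\tau_{\kappa\mu}=6\left(32\kappa^2(4\kappa^2+\kappa)^2\right)^{D_\mu}$. Then $w\in A_{p-\varepsilon}$, where $$\varepsilon=\frac{p-1}{r(\sigma)'}=\frac{p-1}{1+\tau_{\kappa\mu}[\sigma]_{A_\infty}}$$ and $r(\sigma)'$ is the dual exponent of $r(\sigma)$. Furthermore, $$[w]_{A_{p-\varepsilon}}\le 2^{p-1}(4\kappa)^{pD_\mu}[w]_{A_p}.$$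
   Context: A quasimetric on a set $\mathcal S$ is a function $d:\mathcal S\times\mathcal S\to[0,\infty)$ with $d(x,y)=0$ iff $x=y$, $d(x,y)=d(y,x)$, and $d(x,y)\le\kappa(d(x,z)+d(z,y))$ for all $x,y,z$, for some finite constant $\kappa\ge1$ (the quasimetric constant). Balls are $B(x,r)=\{y\in\mathcal S: d(x,y)<r\}$, $r>0$. A space of homogeneous type $(\mathcal S,d,\mu)$ is a set with a quasimetric $d$ and a nonnegative Borel measure $\mu$ such that $\mu(B(x,2r))\le C\mu(B(x,r))$ for all $x\in\mathcal S$, $r>0$. $C_\mu$ denotes the smallest such constant and $D_\mu=\log_2 C_\mu$ is the doubling order. Standing assumptions: $0<\mu(B)<\infty$ for every ball $B$; $d$ is continuous and balls are open; the Lebesgue differentiation theorem holds on $(\mathcal S,d,\mu)$. A weight is a nonnegative measurable function on $\mathcal S$. For $1<q<\infty$, $w\in A_q$ means $$[w]_{A_q}:=\sup_B\left(\frac1{\mu(B)}\int_B w\,d\mu\right)\left(\frac1{\mu(B)}\int_B w^{-\frac1{q-1}}\,d\mu\right)^{q-1}<\infty,$$ the supremum being over all balls in $\mathcal S$ (with the convention $0\cdot\infty=\infty$, so that $A_q$ weights are locally integrable and a.e. positive). The uncentered Hardy-Littlewood maximal operator is $Mf(x)=\sup_{B\ni x}\frac1{\mu(B)}\int_B|f|\,d\mu$ (supremum over balls $B$ containing $x$). With $w(B)=\int_B w\,d\mu$, the $A_\infty$ constant of a weight is $$[w]_{A_\infty}:=\sup_B\frac1{w(B)}\int_B M(w\chi_B)\,d\mu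 .$$ *)

(* Defs.v *)
From HB Require Export structures.
From mathcomp Require Export all_boot all_order all_algebra.
From mathcomp Require Export all_classical all_reals all_analysis.
From mathcomp Require Export measurable_realfun.
Export Order.TTheory GRing.Theory Num.Theory numFieldNormedType.Exports.

Set Implicit Arguments.
Unset Strict Implicit.
Unset Printing Implicit Defensive.

Local Open Scope classical_set_scope.
Local Open Scope ring_scope.

Notation borel S := (g_sigma_algebraType (@open S)).

Section quasimetric.
Context {R : realType} {S : Type}.
Implicit Type d : S -> S -> R.

Definition quasimetric d (kappa : R) : Prop :=
  [/\ 1 <= kappa,
      forall x y, 0 <= d x y,
      forall x y, d x y = 0 <-> x = y,
      forall x y, d x y = d y x &
      forall x y z, d x y <= kappa * (d x z + d z y)].

Definition qball d (x : S) (r : R) : set S := [set y | d x y < r].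

Definition qballs d : set (set S) :=
  [set B | exists x r, 0 < r /\ B = qball d x r].

End quasimetric.

Section homogeneous_space.
Context {R : realType} {S : ptopologicalType}.
Variables (d : S -> S -> R) (mu : {measure set (borel S) -> \bar R}).

Definition doubling (C : R) : Prop := forall x r, 0 < r ->
  (mu (qball d x (2 * r)) <= C%:E * mu (qball d x r))%E.

(* The infimum is attained: balls have positive finite measure, so the set of
   admissible constants is closed and bounded below. *)
Definition doubling_constant : R := inf [set C | doubling C].

Definition doubling_order : R := ln doubling_constant / ln 2.

Definition avg (B : set S) (f : borel S -> \bar R) : \bar R :=
  ((mu B)^-1 * \int[mu]_(y in B) f y)%E.

Definition lebesgue_differentiation : Prop := forall f : borel S -> R,
  (forall B, qballs d B -> mu.-integrable B (EFin \o f)) ->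
  {ae mu, forall x,
    avg (qball d x r) (EFin \o f) @[r --> 0^'+] --> (f x)%:E}.

(* The topology of S is required to be the one induced by d, so that
   [borel S] carries the Borel sigma-algebra of the quasimetric space. *)
Record homogeneous_type (kappa : R) : Prop := HomogeneousType {
  ht_quasimetric : quasimetric d kappa ;
  ht_topology : forall U : set S,
    open U <-> forall x, U x -> exists2 r, 0 < r & qball d x r `<=` U ;
  ht_continuous : continuous (fun z : S * S => d z.1 z.2) ;
  ht_open_ball : forall B, qballs d B -> open B ;
  ht_ball_measure : forall B, qballs d B -> (0 < mu B < +oo)%E ;
  ht_doubling : exists C, doubling C ;
  ht_lebesgue : lebesgue_differentiation }.

(* Weights take values in [0, +oo], so that w^(1-p') is again a weight when
   w vanishes on a null set. *)
Definition weight (w : borel S -> \bar R) : Prop :=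
  measurable_fun [set: borel S] w /\ forall x, (0 <= w x)%E.

(* x^s on [0, +oo] with 0^s = +oo and (+oo)^s = 0 when s < 0; the library has
   0 `^ s = 0 and +oo `^ s = +oo in that case. *)
Definition epow (x : \bar R) (s : R) : \bar R :=
  if s < 0 then (x `^ (- s))^-1%E else (x `^ s)%E.

(* Product on [0, +oo] with 0 * oo = oo (the library's is 0). *)
Definition mule_infty (x y : \bar R) : \bar R :=
  if (x == +oo%E) || (y == +oo%E) then +oo%E else (x * y)%E.

Definition Aq_constant (q : R) (w : borel S -> \bar R) : \bar R :=
  ereal_sup [set mule_infty (avg B w)
                   (avg B (fun x => epow (w x) (- (q - 1)^-1)) `^ (q - 1))%E
            | B in qballs d].

Definition in_Aq (q : R) (w : borel S -> \bar R) : Prop :=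
  [/\ 1 < q, weight w & (Aq_constant q w < +oo)%E].

Definition maximal (f : borel S -> \bar R) (x : S) : \bar R :=
  ereal_sup [set avg B (fun y => `|f y|%E) | B in [set B | qballs d B /\ B x]].

Definition Ainfty_constant (w : borel S -> \bar R) : \bar R :=
  ereal_sup [set ((\int[mu]_(x in B) w x)^-1 *
      \int[mu]_(x in B) maximal (fun y => w y * (\1_B y)%:E) x)%E
    | B in qballs d].

Definition tau (kappa : R) : R :=
  6 * (32 * kappa ^+ 2 * (4 * kappa ^+ 2 + kappa) ^+ 2) `^ doubling_order.

(* r(v); with 1 / oo = 0 it is 1 when the A_infty constant of v is +oo. *)
Definition rh_exponent (kappa : R) (v : borel S -> \bar R) : \bar R :=
  (1 + ((tau kappa)%:E * Ainfty_constant v)^-1)%E.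

End homogeneous_space.

(* Main.v *)
Require Import Defs.
From mathcomp Require Import ring lra.

(** Write [sigma = w `^ (1 - p')], let [A] be its [A_infty] constant, [tau] the
    constant of the statement and [r = 1 + 1 / (tau A)]. The number [eps] is
    chosen so that [- 1 / (p - eps - 1) = r (1 - p')]; thus the second factor of
    the [A_(p - eps)] constant of [w] over a ball [B] is a power of the average of
    [sigma `^ r]. The reverse Hoelder inequality ([reverse_hoelder]) bounds the
    latter by the average of [sigma] over the ball [2 kappa B], doubling bounds
    the average of [w] over [B] by that over [2 kappa B], and the product over
    [2 kappa B] is at most the [A_p] constant ([Aq_constant_open]). If [A] is
    infinite, then [eps = 0] and the claim is that the constant is at least 1.

    For the reverse Hoelder inequality for a weight [v] over a ball [Q], let [u] be
    the maximal function formed with the balls centred in [Q] whose radius does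
    not exceed that of [Q]. Then [v <= u] almost everywhere on [Q], by the
    Lebesgue differentiation theorem ([le_local_maximal_ae]). For [t] above a
    multiple of the average of [v] over [2 kappa Q], select among the balls with
    average above [t] those of almost maximal radius, and extract a disjoint
    Vitali subfamily ([vitali_covering], [stopping_cover]). Its dilates [B_i]
    satisfy [v(B_i) <= c t mu(Q_i)], where [Q_i] are the disjoint balls, and each
    ball with average above [t] lies in a single [B_i]. This has two consequences.
    The mass of [v] on the level set [{u > t}] is at most [c t mu{u > t}]
    ([integral_weight_above]). Moreover [u] is dominated there by the sum of
    the maximal functions of [v 1_(B_i)] restricted to [B_i], so the [A_infty]
    condition bounds the integral of [u] over [{u > t}] by [A c t mu{u > t}]
    ([integral_local_maximal_above]).

    Summing these two bounds over the levels [t = 2^k l] with weights that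
    approximate [u `^ e], [e = r - 1], gives first a bound for the integral of
    [u `^ (1 + e)] by absorption, since [e A c] is small, and then one for the
    integral of [v u `^ e], in which the factor [A] is cancelled by [e]
    ([self_improvement]). *)

Set Implicit Arguments.
Unset Strict Implicit.
Unset Printing Implicit Defensive.

Local Open Scope classical_set_scope.
Local Open Scope ring_scope.

(** * Quasimetric balls and the Vitali covering lemma *)

Section quasimetric_geometry.
Context {R : realType} {S : Type} (d : S -> S -> R) (kappa : R).
Hypothesis qd : quasimetric d kappa.
Local Notation theta := (4 * kappa ^+ 2 + kappa).

Lemma qball_center x r : 0 < r -> qball d x r x.
Proof.
move=> r0; rewrite /qball /=.
by case: qd => _ _ /(_ x x)[_ ->].
Qed.

Lemma le_qball x r s : r <= s -> qball d x r `<=` qball d x s.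
Proof. by move=> rs y /= /lt_le_trans; apply. Qed.

Lemma qball_enlarge x y r s : qball d x r y ->
  qball d y s `<=` qball d x (kappa * (r + s)).
Proof.
move=> /= xy z /= yz; case: qd => k1 d0 _ _ tri.
apply: le_lt_trans (tri _ _ y) _.
by rewrite ltr_pM2l ?ltrD// (lt_le_trans ltr01).
Qed.

Lemma qball_sym x y r : qball d x r y -> qball d y r x.
Proof. by rewrite /qball/=; case: qd => _ _ _ -> _. Qed.

(** The engulfing property behind the covering lemma: passing to a point common
    to both balls costs one factor [kappa], crossing the second ball another. *)
Lemma qball_engulf x y r s : 0 < r -> s <= 2 * r ->
  qball d x r `&` qball d y s !=set0 -> qball d y s `<=` qball d x (theta * r).
Proof.
move=> r0 sr [z [xz /qball_sym zy]]; have [k1 _ _ _ _] := qd.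
apply: (subset_trans (qball_enlarge zy)).
apply: (subset_trans (qball_enlarge xz)).
apply: le_qball.
nra.
Qed.

(** The classical greedy selection, done by one application of Zorn's lemma to
    the disjoint subfamilies [H] in which every ball of [F] that meets [H] meets
    a member of [H] with at least half its radius. A maximal [H] meets every
    ball of [F]: otherwise a ball missing [H] whose radius exceeds half the
    supremum of such radii could be added. The conclusion is stated for whole
    balls of [F], and not only for their union, because the estimate of the
    maximal function below needs each ball inside a single dilate. *)
Lemma vitali_covering (F : set (S * R)) (rho : R) :
    (forall c, F c -> 0 < c.2 <= rho) ->
  exists G : set (S * R), [/\ G `<=` F,
    trivIset G (fun c => qball d c.1 c.2) &
    forall c, F c -> exists2 g, G g &
      qball d c.1 c.2 `<=` qball d g.1 (theta * g.2)].
Proof.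
move=> Frho.
pose B (c : S * R) := qball d c.1 c.2.
pose P (H : set (S * R)) := [/\ H `<=` F, trivIset H B &
  forall c, F c -> (exists2 h, H h & B h `&` B c !=set0) ->
    exists h, [/\ H h, B h `&` B c !=set0 & c.2 <= 2 * h.2]].
have [C CP totC|H [[HF tH PH] maxH]] := @Zorn_bigcup _ P.
  split.
  - by move=> c [H CH Hc]; have [+ _ _] := CP _ CH; apply.
  - move=> c c' [H CH Hc] [H' CH' Hc'].
    have [HH'|H'H] := totC _ _ CH CH'.
    + by have [_ + _] := CP _ CH'; apply => //; exact: HH'.
    + by have [_ + _] := CP _ CH; apply => //; exact: H'H.
  - move=> c Fc [h [H CH Hh] hc]; have [_ _ PH] := CP _ CH.
    have [||h' [Hh' h'c ch']] := PH c; [by []|by exists h|].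
    by exists h'; split => //; exists H.
exists H; split=> // c Fc.
have [[h Hh hc]|nHc] := pselect (exists2 h, H h & B h `&` B c !=set0).
  have [||h' [Hh' h'c ch']] := PH c; [by []|by exists h|].
  by exists h' => //; apply: qball_engulf => //; case/andP: (Frho _ (HF _ Hh')).
exfalso.
(* [N] collects the balls of [F] that miss every member of [H]. *)
pose N := [set c | F c /\ ~ exists2 h, H h & B h `&` B c !=set0].
have supN : has_sup (snd @` N).
  split; first by exists c.2, c.
  by exists rho => _ [e [Fe _] <-]; case/andP: (Frho _ Fe).
pose s := sup (snd @` N).
have ub e : N e -> e.2 <= s by move=> Ne; apply: sup_upper_bound => //; exists e.
have s0 : 0 < s.
  by apply: lt_le_trans (ub c _) => //; case/andP: (Frho _ Fc).
have [_ [c0 [Fc0 nHc0] <-]] := @sup_adherent _ (snd @` N) (s / 2) ltac:(lra) supN.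
rewrite -/s => c0s.
have c00 : 0 < c0.2 by case/andP: (Frho _ Fc0).
have Bc0 : B c0 c0.1 by exact: qball_center.
have nHc0' : ~ H c0 by move=> Hc0; apply: nHc0; exists c0 => //; exists c0.1.
apply: (maxH (c0 |` H)).
  split; first by move=> h Hh; right.
  by move=> /(_ c0 (or_introl erefl)).
split.
- by move=> e [->//|/HF].
- move=> a b [->|Ha] [->|Hb] ab //.
  + by exfalso; apply: nHc0; exists b => //; rewrite setIC.
  + by exfalso; apply: nHc0; exists a.
  + exact: tH.
- move=> e Fe [h hH he].
  have [HHe|nHe] := pselect (exists2 h, H h & B h `&` B e !=set0).
    by have [k [Hk ? ?]] := PH _ Fe HHe; exists k; split => //; right.
  case: hH => [hE|Hh]; last by exfalso; apply: nHe; exists h.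
  exists c0; split; [by left|by rewrite -hE|].
  have /ub : N e by []. lra.
Qed.

End quasimetric_geometry.

(** * Consequences of doubling *)

Section doubling.
Context {R : realType} {S : ptopologicalType} (d : S -> S -> R)
  (mu : {measure set (borel S) -> \bar R}) (kappa : R).
Hypothesis hS : homogeneous_type d mu kappa.
Local Notation D := (doubling_order d mu).
Local Notation C := (doubling_constant d mu).

Lemma qballs_qball x r : 0 < r -> qballs d (qball d x r).
Proof. by move=> r0; exists x, r. Qed.

Lemma kappa_ge1 : 1 <= kappa.
Proof. by case: (ht_quasimetric hS). Qed.

Lemma measurable_open (U : set S) : open U -> measurable (U : set (borel S)).
Proof. by move=> oU; apply: sub_sigma_algebra. Qed.

Lemma measurable_qballs B : qballs d B -> measurable (B : set (borel S)).
Proof. by move=> /(ht_open_ball hS)/measurable_open. Qed.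

Lemma measurable_qball x r : 0 < r -> measurable (qball d x r : set (borel S)).
Proof. by move=> /(qballs_qball x)/measurable_qballs. Qed.

Lemma mu_qballs_fin B : qballs d B -> mu B \is a fin_num.
Proof. by move=> /(ht_ball_measure hS)/andP[/ltW ? ?]; rewrite ge0_fin_numE. Qed.

Lemma mu_qballs_gt0 B : qballs d B -> (0 < mu B)%E.
Proof. by move=> /(ht_ball_measure hS)/andP[]. Qed.

Let le1C c : doubling d mu c -> 1 <= c.
Proof.
move=> /(_ point 1 ltr01).
have B1 := qballs_qball point ltr01; have B2 := qballs_qball point (@ltr0n R 2).
have : (mu (qball d point 1) <= mu (qball d point (2 * 1)))%E.
  apply: le_measure; rewrite ?inE; [exact: measurable_qball..|].
  by apply: le_qball; lra.
move: (mu_qballs_gt0 B1) (mu_qballs_fin B1).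
case: (mu _) => // m m0 _ h1 h2.
have := le_trans h1 h2; rewrite -EFinM lee_fin; rewrite lte_fin in m0.
by rewrite -[leLHS]mul1r ler_pM2r.
Qed.

(** The infimum defining the doubling constant is attained, because the measures
    of balls are finite and positive. *)
Lemma doubling_constantP : doubling d mu C.
Proof.
move=> x r r0.
have B1 := qballs_qball x r0.
have B2 : qballs d (qball d x (2 * r)) by apply: qballs_qball; lra.
move: (mu_qballs_gt0 B1) (mu_qballs_fin B1) (mu_qballs_gt0 B2) (mu_qballs_fin B2).
have : forall c, doubling d mu c ->
  (mu (qball d x (2 * r)) <= c%:E * mu (qball d x r))%E by move=> c /(_ x r r0).
case: (mu _) => // m; case: (mu _) => // n H n0 _ m0 _.
rewrite -EFinM lee_fin; rewrite !lte_fin in n0 m0.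
rewrite -ler_pdivrMr//; apply: lb_le_inf.
  by case: (ht_doubling hS) => c dc; exists c.
by move=> c /H; rewrite -EFinM lee_fin ler_pdivrMr.
Qed.

Lemma doubling_constant_ge1 : 1 <= C.
Proof. exact/le1C/doubling_constantP. Qed.

Lemma doubling_order_ge0 : 0 <= D.
Proof.
by rewrite divr_ge0 ?ln_ge0 ?doubling_constant_ge1//; lra.
Qed.

Lemma doubling_constantE : C = 2 `^ D.
Proof.
have C0 : 0 < C by exact: lt_le_trans ltr01 doubling_constant_ge1.
rewrite /powR pnatr_eq0/= /doubling_order divfK ?lnK ?posrE//.
by rewrite gt_eqF// ln_gt0//; lra.
Qed.

Lemma doubling_iter k x r : 0 < r ->
  (mu (qball d x (2 ^+ k * r)) <= (C ^+ k)%:E * mu (qball d x r))%E.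
Proof.
move=> r0; elim: k => [|k IH]; first by rewrite !expr0 mul1r mul1e.
rewrite exprS -mulrA.
apply: le_trans (doubling_constantP _ _) _.
  by rewrite mulr_gt0 ?exprn_gt0.
rewrite exprS EFinM -muleA; apply: lee_wpmul2l => //.
by rewrite lee_fin (le_trans ler01 doubling_constant_ge1).
Qed.

(** The factor 2 in front of [l] is lost when [l] is rounded up to a power of
    two. *)
Lemma mu_qball_scale l x r : 0 < r -> 1 <= l ->
  (mu (qball d x (l * r)) <= ((2 * l) `^ D)%:E * mu (qball d x r))%E.
Proof.
move=> r0 l1; have l0 : 0 < l by lra.
have /ex_minnP[k lk mink] : exists k, l <= 2 ^+ k.
  exists (Num.bound l); apply: ltW; apply: lt_le_trans (archi_boundP _) _; first lra.
  by rewrite -natrX ler_nat ltnW// ltn_expl.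
have k2 : 2 ^+ k <= 2 * l.
  case: k lk mink => [|k] lk mink; first by rewrite expr0; lra.
  rewrite exprS ler_pM2l//; rewrite leNgt; apply/negP => /ltW/mink.
  by rewrite ltnn.
have lr : l * r <= 2 ^+ k * r by rewrite ler_pM2r.
apply: (@le_trans _ _ (mu (qball d x (2 ^+ k * r)))).
  apply: le_measure; rewrite ?inE; last exact: le_qball.
  - by apply: measurable_qball; rewrite mulr_gt0.
  - by apply: measurable_qball; rewrite mulr_gt0 ?exprn_gt0.
apply: le_trans (doubling_iter _ _ r0) _.
apply: lee_wpmul2r => //; rewrite lee_fin doubling_constantE.
rewrite -powR_mulrn ?powR_ge0// -powRrM mulrC powRrM powR_mulrn//.
by apply: ge0_ler_powR; rewrite ?nnegrE ?doubling_order_ge0 ?exprn_ge0//; lra.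
Qed.

End doubling.

(** * Countable covers and measurability *)

Section measure_lemmas.
Context {R : realType} {dd} {T : measurableType dd}
  (mu : {measure set T -> \bar R}).

Lemma emeasurable_funP_gt (f : T -> \bar R) :
  (forall r : R, measurable [set x | (r%:E < f x)%E]) -> measurable_fun [set: T] f.
Proof.
move=> mf mD; apply: (measurability _ (ErealGenOInfty.measurableE R)) => //.
move=> _ [_ [r ->] <-]; rewrite setTI.
rewrite (_ : _ @^-1` _ = [set x | (r%:E < f x)%E])//.
by apply/seteqP; split=> x /=; rewrite in_itv/= andbT.
Qed.

Lemma nneseries_term_le (F : nat -> \bar R) (I : set nat) i : I i ->
  (forall k, (0 <= F k)%E) -> (F i <= \sum_(k <oo | k \in I) F k)%E.
Proof.
move=> Ii F0; rewrite (@nneseriesD1 _ _ i)//; last by rewrite inE.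
by rewrite leeDl// nneseries_ge0.
Qed.

(** Countable subadditivity of the integral, in a form where the function
    integrated may change from one set of the cover to the next; for a maximal
    function these are the maximal functions localized to each set. *)
Lemma integral_cover (f : T -> \bar R) (U : set T) (I : set nat)
    (B : nat -> set T) (g : nat -> T -> \bar R) :
  measurable U -> measurable_fun U f -> (forall x, (0 <= f x)%E) ->
  (forall i, I i -> measurable (B i)) ->
  (forall i, measurable_fun [set: T] (g i)) -> (forall i x, (0 <= g i x)%E) ->
  (forall x, U x -> (f x <= \sum_(i <oo | i \in I) (g i \_ (B i)) x)%E) ->
  (\int[mu]_(x in U) f x <= \sum_(i <oo | i \in I) \int[mu]_(x in B i) g i x)%E.
Proof.
move=> mU mf f0 mB mg g0 fg.
pose h i x := if i \in I then (g i \_ (B i)) x else 0%E.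
have gB0 i x : (0 <= (g i \_ (B i)) x)%E by rewrite /patch; case: ifP.
have h0 i x : (0 <= h i x)%E by rewrite /h; case: ifP.
have mh i : measurable_fun [set: T] (h i).
  rewrite /h; case: (boolP (i \in I)) => [/set_mem Ii|_]; last exact: measurable_cst.
  by apply/(measurable_restrictT (g i) (mB _ Ii)); exact: measurable_funTS.
have mhU : measurable_fun U (fun x => \sum_(i <oo) h i x)%E.
  by apply: measurable_funTS; exact: (@ge0_emeasurable_sum _ _ _ _ h xpredT).
apply: (@le_trans _ _ (\int[mu]_(x in U) \sum_(i <oo) h i x)%E).
  apply: ge0_le_integral => // x Ux.
  by apply: le_trans (fg _ Ux) _; rewrite eseries_mkcond.
apply: (@le_trans _ _ (\int[mu]_x \sum_(i <oo) h i x)%E).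
  apply: ge0_subset_integral => //; first exact: (@ge0_emeasurable_sum _ _ _ _ h xpredT).
  by move=> x _; apply: nneseries_ge0.
rewrite integral_nneseries// [leRHS]eseries_mkcond.
apply: lee_nneseries => [i _ _|i _]; first exact: integral_ge0.
rewrite /h; case: ifPn => _; first by rewrite [leRHS]integral_mkcond.
by rewrite integral0.
Qed.

(** Only finitely many disjoint subsets of [V] can have measure above [1 / n].
    Hence the disjoint family of balls provided by Zorn's lemma is countable. *)
Lemma countable_trivIset_gt0 (J : pointedType) (G : set J) (B : J -> set T)
    (V : set T) : measurable V -> (mu V < +oo)%E ->
  (forall j, G j -> [/\ measurable (B j), (0 < mu (B j))%E & B j `<=` V]) ->
  trivIset G B -> countable G.
Proof.
move=> mV Voo GB tB.
have GE : G = \bigcup_n [set j | G j /\ ((n.+1%:R^-1)%:E < mu (B j))%E].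
  apply/seteqP; split=> [j Gj|j [n _ []]//].
  have [mBj Bj0 BV] := GB _ Gj.
  have Bjfin : mu (B j) \is a fin_num.
    rewrite ge0_fin_numE// (le_lt_trans _ Voo)//.
    by apply: le_measure; rewrite ?inE.
  have : 0 < fine (mu (B j)) by rewrite fine_gt0// Bj0 -ge0_fin_numE.
  move=> /ltr_add_invr[k]; rewrite add0r => kB.
  by exists k => //; split => //; rewrite -(fineK Bjfin) lte_fin.
rewrite GE; apply: bigcup_countable => // n _; apply: finite_set_countable.
apply: contrapT => /infiniteP/pcard_leP/injfunPex[/= q q_fun q_inj].
have qG k : G (q k) by have [] := q_fun k I.
have qn k : ((n.+1%:R^-1)%:E < mu (B (q k)))%E by have [] := q_fun k I.
have tBq : trivIset setT (B \o q).
  move=> i j _ _ /= ij; apply: q_inj; rewrite ?inE//; exact: tB.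
have mBq k : measurable (B (q k)) by have [] := GB _ (qG k).
have : (mu (\bigcup_k B (q k)) <= mu V)%E.
  apply: le_measure; rewrite ?inE//; first exact: bigcup_measurable.
  by move=> x [k _]; have [_ _] := GB _ (qG k); apply.
rewrite measure_bigcup// => qV.
have lb m : ((m%:R * n.+1%:R^-1)%:E <= mu V)%E.
  apply: le_trans qV.
  apply: le_trans (nneseries_lim_ge m _); last by [].
  rewrite (_ : (m%:R * n.+1%:R^-1)%:E = \sum_(0 <= k < m) (n.+1%:R^-1)%:E)%E; last first.
    by rewrite sumEFin sumr_const_nat subn0 mulr_natl.
  rewrite [leRHS]big_mkcond/=; apply: lee_sum => k _.
  by rewrite in_setT ltW.
have Vfin : mu V \is a fin_num by rewrite ge0_fin_numE.
have v0 : 0 <= fine (mu V) * n.+1%:R by rewrite mulr_ge0// fine_ge0.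
have := archi_boundP v0; rewrite -ltr_pdivlMr// ltNge.
by rewrite -lee_fin (fineK Vfin) lb.
Qed.

End measure_lemmas.

(** * Self-improvement of integrability from level set estimates *)

(** Bernoulli's inequality for exponents in [0, 1]: convexity of the exponential
    on the segment between [0] and [ln x]. *)
Lemma powR_le_affine {R : realType} (x e : R) : 0 < x -> 0 <= e <= 1 ->
  x `^ e <= 1 + e * (x - 1).
Proof.
move=> x0 /andP[e0 e1].
have := convex_expR (Itv01 e0 e1) (ln x : R^o) (0 : R^o).
rewrite !convRE /= expR0 lnK ?posrE// mulr0 addr0 /powR gt_eqF//.
by move=> /le_trans; apply; rewrite /unstable.onem; lra.
Qed.

Section dyadic_layer_cake.
Context {R : realType} {dd} {T : measurableType dd}
  (mu : {measure set T -> \bar R}).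
Variables (u : T -> \bar R) (l e : R).
Hypotheses (mfu : measurable_fun [set: T] u) (u0 : forall x, (0 <= u x)%E)
  (l0 : 0 < l) (e0 : 0 <= e) (e1 : e <= 1).

Definition level k : R := 2 ^+ k * l.
Definition above k : set T := [set x | ((level k)%:E < u x)%E].
Definition jump k : R := level k.+1 `^ e - level k `^ e.
(** A dyadic staircase lying above the power [e] of [u] truncated at [level n].
    Replacing the layer cake integral over all levels by this sum keeps Fubini's
    theorem out of the argument; the price is the factor 2 in [wstep_le_step]. *)
Definition step n x : R := l `^ e + \sum_(k < n) jump k * \1_(above k) x.
Definition wstep n x : R := \sum_(k < n) jump k * level k * \1_(above k) x.

Let level_gt0 k : 0 < level k.
Proof. by rewrite mulr_gt0 ?exprn_gt0. Qed.

Let levelS k : level k.+1 = 2 * level k.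
Proof. by rewrite /level exprS mulrA. Qed.

Let level_le k m : (k <= m)%N -> level k <= level m.
Proof.
by move=> km; rewrite ler_pM2r// ler_eXn2l//; lra.
Qed.

Let jump_ge0 k : 0 <= jump k.
Proof.
rewrite subr_ge0; apply: ge0_ler_powR; rewrite ?nnegrE ?(ltW (level_gt0 _))//.
exact: level_le.
Qed.

Let jump_le k : jump k <= e * level k `^ e.
Proof.
rewrite /jump levelS powRM ?(ltW (level_gt0 _))//.
have : (2 : R) `^ e <= 1 + e * (2 - 1) by apply: powR_le_affine; rewrite ?e0 ?e1.
have := powR_ge0 (level k) e; nra.
Qed.

Lemma measurable_above k : measurable (above k).
Proof. by rewrite -[above k]setTI; exact: emeasurable_fun_o_infty. Qed.

Lemma stepS n x : step n.+1 x = step n x + jump n * \1_(above n) x.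
Proof. by rewrite /step big_ord_recr/= addrA. Qed.

Lemma wstepS n x : wstep n.+1 x = wstep n x + jump n * level n * \1_(above n) x.
Proof. by rewrite /wstep big_ord_recr. Qed.

Lemma step_ge0 n x : 0 <= step n x.
Proof.
by rewrite addr_ge0 ?powR_ge0// sumr_ge0// => k _; rewrite mulr_ge0.
Qed.

Lemma wstep_ge0 n x : 0 <= wstep n x.
Proof.
by rewrite sumr_ge0// => k _; rewrite !mulr_ge0// ltW// level_gt0.
Qed.

Lemma step_nd x : {homo step^~ x : n m / (n <= m)%N >-> n <= m}.
Proof.
by apply/nondecreasing_seqP => n; rewrite stepS lerDl mulr_ge0.
Qed.

Lemma step_le n x : step n x <= level n `^ e.
Proof.
elim: n => [|n IH]; first by rewrite /step big_ord0 addr0 /level expr0 mul1r.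
rewrite stepS -[leRHS](subrKC (level n `^ e)) lerD//.
by rewrite -[leRHS]mulr1 ler_wpM2l// indicE; case: (_ \in _).
Qed.

Lemma step_above n x : ((level n)%:E < u x)%E -> step n x = level n `^ e.
Proof.
elim: n => [|n IH] nx; first by rewrite /step big_ord0 addr0 /level expr0 mul1r.
have nx' : ((level n)%:E < u x)%E.
  by apply: le_lt_trans nx; rewrite lee_fin level_le.
by rewrite stepS IH// indicE mem_set// mulr1 subrKC.
Qed.

(** Stated for a number [t] below [u] so that it can be used with [t] the value
    of a function that [u] dominates, even where [u] is infinite. *)
Lemma step_ge n x t : 0 <= t -> (t%:E <= u x)%E -> t <= level n ->
  t `^ e <= step n x.
Proof.
move=> t0 tu; elim: n => [|n IH] tn.
  rewrite /step big_ord0 addr0; apply: ge0_ler_powR => //.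
    by rewrite nnegrE ltW.
  by rewrite (le_trans tn)// /level expr0 mul1r.
have [nx|xn] := ltP (level n)%:E (u x).
  rewrite stepS step_above// indicE mem_set// mulr1 subrKC.
  by apply: ge0_ler_powR; rewrite ?nnegrE// ltW.
rewrite (le_trans (IH _))//; first by rewrite -lee_fin (le_trans tu).
exact: step_nd.
Qed.

Let indic01 k x : 0 <= (\1_(above k) x : R) <= 1.
Proof. by rewrite indicE; case: (_ \in _); rewrite /= ?lexx ?ler01. Qed.

Let wstep_le n x : wstep n.+1 x <= 2 * e * (level n `^ e * level n).
Proof.
elim: n => [|n IH].
  rewrite wstepS /wstep big_ord0 add0r.
  have := jump_le 0; have := level_gt0 0; have := powR_ge0 (level 0) e.
  have := indic01 0 x.
  have := jump_ge0 0.
  set a := jump 0; set b := level 0; set c := \1__ _; set f := _ `^ _.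
  move=> a0 /andP[c0 c1] f0 b0 af.
  have : a * b * c <= a * b by rewrite ler_piMr// mulr_ge0// ltW.
  have : a * b <= e * f * b by rewrite ler_pM2r.
  have : 0 <= e * (f * b) by rewrite !mulr_ge0// ltW.
  lra.
rewrite wstepS.
have := jump_le n.+1; have := level_gt0 n; have := powR_ge0 (level n) e.
have := indic01 n.+1 x.
have := jump_ge0 n.+1.
have : level n `^ e <= level n.+1 `^ e.
  by apply: ge0_ler_powR; rewrite ?nnegrE ?(ltW (level_gt0 _)) ?level_le.
move: IH; rewrite levelS.
set a := jump n.+1; set b := level n; set c := \1__ _; set f := b `^ _.
set g := (2 * b) `^ _.
move=> IH fg a0 /andP[c0 c1] f0 b0 af.
have : a * (2 * b) * c <= a * (2 * b) by rewrite ler_piMr// !mulr_ge0// ltW.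
have : a * (2 * b) <= e * g * (2 * b) by rewrite ler_pM2r//; lra.
have : e * (f * b) <= e * (g * b) by rewrite ler_wpM2l// ler_pM2r.
lra.
Qed.

(** Where [level m < u <= level m.+1], the sum [wstep] is a sum of increments at
    most [e * level m `^ e * level k] over [k <= m], a geometric sum dominated
    by twice its last term. *)
Lemma wstep_le_step n x :
  ((wstep n x)%:E <= (2 * e)%:E * (u x * (step n x)%:E))%E.
Proof.
elim: n => [|n IH].
  by rewrite /wstep big_ord0 !mule_ge0// lee_fin ?mulr_ge0// step_ge0.
have [nx|xn] := ltP (level n)%:E (u x).
  apply: (@le_trans _ _ (2 * e * (level n `^ e * level n))%:E).
    by rewrite lee_fin.
  rewrite EFinM lee_wpmul2l ?lee_fin ?mulr_ge0// mulrC EFinM.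
  apply: lee_pmul; rewrite ?lee_fin ?powR_ge0 ?(ltW (level_gt0 _)) ?(ltW nx)//.
  by rewrite -(step_above nx) step_nd.
have nab : \1_(above n) x = 0 :> R.
  by rewrite indicE memNset//= => /lt_le_trans/(_ xn); rewrite ltxx.
by rewrite wstepS stepS nab !mulr0 !addr0.
Qed.

Lemma measurable_step n D : measurable_fun D (EFin \o step n).
Proof.
apply/measurable_EFinP; apply: measurable_funTS; apply: measurable_funD => //.
apply: measurable_sum => k; apply: measurable_funM => //.
exact/measurable_indic/measurable_above.
Qed.

Lemma measurable_wstep n D : measurable_fun D (EFin \o wstep n).
Proof.
apply/measurable_EFinP; apply: measurable_funTS.
apply: measurable_sum => k; apply: measurable_funM => //.
exact/measurable_indic/measurable_above.
Qed.

Lemma integral_step (D : set T) (f : T -> \bar R) n : measurable D ->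
  measurable_fun D f -> (forall x, D x -> (0 <= f x)%E) ->
  (\int[mu]_(x in D) (f x * (step n x)%:E) = (l `^ e)%:E * \int[mu]_(x in D) f x
   + \sum_(k < n) (jump k)%:E * \int[mu]_(x in D `&` above k) f x)%E.
Proof.
move=> mD mf f0; elim: n => [|n IH].
  rewrite big_ord0 adde0 -ge0_integralZl_EFin ?powR_ge0//.
  by apply: eq_integral => x _; rewrite /step big_ord0 addr0 muleC.
rewrite big_ord_recr/= addeA -IH integral_mkcondr -ge0_integralZl_EFin//; last 2 first.
- by move=> x Dx; rewrite /patch; case: ifP => // _; exact: f0.
- apply/measurable_restrict => //; first exact: measurable_above.
  by apply: measurable_funS mf => //; exact: subIsetl.
rewrite -ge0_integralD//.
- apply: eq_integral => x /set_mem Dx.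
  rewrite stepS EFinD ge0_muleDr ?lee_fin ?step_ge0 ?mulr_ge0//.
  congr (_ + _)%E; rewrite indicE /patch; case: (x \in above n).
    by rewrite mulr1 muleC.
  by rewrite mulr0 !mule0.
- by move=> x Dx; rewrite mule_ge0 ?f0// lee_fin step_ge0.
- by apply: emeasurable_funM => //; exact: measurable_step.
- move=> x Dx; rewrite mule_ge0 ?lee_fin// /patch; case: ifP => // _; exact: f0.
- apply: emeasurable_funM => //.
  apply/measurable_restrict => //; first exact: measurable_above.
  by apply: measurable_funS mf => //; exact: subIsetl.
Qed.

Lemma integral_wstep n : (\int[mu]_x (wstep n x)%:E =
   \sum_(k < n) (jump k)%:E * ((level k)%:E * mu (above k)))%E.
Proof.
elim: n => [|n IH].
  by rewrite big_ord0; apply: integral0_eq => x _; rewrite /wstep big_ord0.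
rewrite big_ord_recr/= -IH.
under eq_integral do rewrite wstepS EFinD.
have ln0 : 0 <= jump n * level n by rewrite mulr_ge0// ltW.
rewrite ge0_integralD//; last 4 first.
- by move=> x _; rewrite lee_fin wstep_ge0.
- exact: measurable_wstep.
- by move=> x _; rewrite lee_fin mulr_ge0.
- apply/measurable_EFinP; apply: measurable_funM => //.
  exact/measurable_indic/measurable_above.
congr (_ + _)%E; under eq_integral do rewrite EFinM.
rewrite ge0_integralZl_EFin//.
- by rewrite integral_indic ?setIT ?EFinM ?muleA//; exact: measurable_above.
- by apply/measurable_EFinP; exact/measurable_indic/measurable_above.
Qed.

End dyadic_layer_cake.

Section self_improvement.
Context {R : realType} {dd} {T : measurableType dd}
  (mu : {measure set T -> \bar R}).
Variables (u w : T -> \bar R) (Q : set T) (W A c l e : R).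
Hypotheses (mQ : measurable Q)
  (mfu : measurable_fun [set: T] u) (u0 : forall x, (0 <= u x)%E)
  (mw : measurable_fun [set: T] w) (w0 : forall x, (0 <= w x)%E)
  (l0 : 0 < l) (e0 : 0 <= e) (e1 : e <= 1) (c0 : 0 <= c) (A0 : 0 <= A)
  (W0 : 0 <= W) (Ace : 6 * (A * c) * e <= 1).
Hypotheses (intu : (\int[mu]_x u x <= (A * W)%:E)%E)
  (intw : (\int[mu]_(x in Q) w x <= W%:E)%E)
  (uppu : forall t, l <= t -> (\int[mu]_(x in [set x | t%:E < u x]) u x <=
     (A * c * t)%:E * mu [set x | t%:E < u x])%E)
  (uppw : forall t, l <= t -> (\int[mu]_(x in Q `&` [set x | t%:E < u x]) w x <=
     (c * t)%:E * mu [set x | t%:E < u x])%E)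
  (wu : {ae mu, forall x, Q x -> (w x < +oo)%E /\ (w x <= u x)%E}).

Local Notation above := (above u l).
Local Notation step := (step u l e).
Local Notation wstep := (wstep u l e).
Local Notation jump := (jump l e).
Local Notation level := (level l).

Let level_ge k : l <= level k.
Proof. by rewrite -[leLHS]mul1r ler_pM2r// exprn_ege1//; lra. Qed.

Let jump_ge0 k : 0 <= jump k.
Proof.
have lk := level_ge k.
rewrite subr_ge0; apply: ge0_ler_powR; rewrite ?nnegrE//; last first.
- by rewrite ler_pM2r// ler_eXn2l//; lra.
- exact/ltW/(lt_le_trans l0)/level_ge.
- exact/ltW/(lt_le_trans l0)/level_ge.
Qed.

Let sum_le a (F : nat -> \bar R) n : 0 <= a ->
  (forall k, F k <= (a * level k)%:E * mu (above k))%E ->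
  (\sum_(k < n) (jump k)%:E * F k <= a%:E * \int[mu]_x (wstep n x)%:E)%E.
Proof.
move=> a0 Fa; rewrite integral_wstep// ge0_sume_distrr; last first.
  move=> k _; rewrite !mule_ge0 ?lee_fin ?jump_ge0//.
  exact/ltW/(lt_le_trans l0)/level_ge.
apply: lee_sum => k _; rewrite muleCA lee_wpmul2l ?lee_fin//.
by rewrite muleA -EFinM.
Qed.

Let X n : \bar R := (\int[mu]_x (u x * (step n x)%:E))%E.

Let integral_wstep_le n : (\int[mu]_x (wstep n x)%:E <= (2 * e)%:E * X n)%E.
Proof.
rewrite -ge0_integralZl_EFin//; last 3 first.
- by move=> x _; rewrite mule_ge0// lee_fin step_ge0.
- by apply: emeasurable_funM => //; exact: measurable_step.
- by rewrite mulr_ge0.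
apply: ge0_le_integral => //.
- by move=> x _; rewrite lee_fin wstep_ge0.
- exact: measurable_wstep.
- apply: emeasurable_funM => //.
  by apply: emeasurable_funM => //; exact: measurable_step.
- by move=> x _; exact: wstep_le_step.
Qed.

(* Finiteness is what allows absorbing [X n] in the next step. *)
Let X_fin n : X n \is a fin_num.
Proof.
rewrite ge0_fin_numE; last first.
  by apply: integral_ge0 => x _; rewrite mule_ge0// lee_fin step_ge0.
apply: (@le_lt_trans _ _ ((level n `^ e)%:E * (A * W)%:E)%E); last exact: ltry.
apply: (@le_trans _ _ ((level n `^ e)%:E * \int[mu]_x u x)%E); last first.
  by rewrite lee_wpmul2l// lee_fin powR_ge0.
rewrite -ge0_integralZl_EFin ?powR_ge0//; apply: ge0_le_integral => //.
- by move=> x _; rewrite mule_ge0// lee_fin step_ge0.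
- by apply: emeasurable_funM => //; exact: measurable_step.
- by apply: emeasurable_funM.
- by move=> x _; rewrite muleC lee_wpmul2r// lee_fin step_le.
Qed.

Let X_le n : (X n <= (3 / 2 * (l `^ e * (A * W)))%:E)%E.
Proof.
have : (X n <= (l `^ e * (A * W))%:E + (A * c)%:E * ((2 * e)%:E * X n))%E.
  rewrite {1}/X integral_step//; apply: leeD.
    by rewrite EFinM lee_wpmul2l// lee_fin powR_ge0.
  apply: le_trans (lee_wpmul2l _ (integral_wstep_le n)); last first.
    by rewrite lee_fin mulr_ge0.
  apply: (@sum_le _ (fun k => \int[mu]_(x in setT `&` above k) u x)%E); first by rewrite mulr_ge0.
  by move=> k; rewrite setTI; exact: uppu.
have := X_fin n; have : (0 <= X n)%E.
  by apply: integral_ge0 => x _; rewrite mule_ge0// lee_fin step_ge0.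
case: (X n) => // x; rewrite !lee_fin => x0 _.
have : 6 * (A * c) * e * x <= 1 * x by rewrite ler_wpM2r.
lra.
Qed.

Let Y_le n :
  (\int[mu]_(x in Q) (w x * (step n x)%:E) <= (3 / 2 * (l `^ e * W))%:E)%E.
Proof.
have mwQ : measurable_fun Q w by exact: measurable_funTS.
rewrite integral_step//.
apply: (@le_trans _ _ ((l `^ e * W)%:E + c%:E * ((2 * e)%:E *
    (3 / 2 * (l `^ e * (A * W)))%:E))%E).
  apply: leeD; first by rewrite EFinM lee_wpmul2l// lee_fin powR_ge0.
  apply: (@le_trans _ _ (c%:E * \int[mu]_x (wstep n x)%:E)%E).
    apply: (@sum_le _ (fun k => \int[mu]_(x in Q `&` above k) w x)%E) => // k.
    exact: uppw.
  rewrite lee_wpmul2l ?lee_fin// (le_trans (integral_wstep_le n))//.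
  by rewrite lee_wpmul2l ?lee_fin ?mulr_ge0.
rewrite -!EFinM -EFinD lee_fin.
have lW : 0 <= l `^ e * W by rewrite mulr_ge0// powR_ge0.
have : 6 * (A * c) * e * (l `^ e * W) <= 1 * (l `^ e * W) by rewrite ler_wpM2r.
lra.
Qed.

(** The self-improvement step. Assume that the integrals of [u] and [w] over the
    upper level sets of [u] are at most [A * c * t], respectively [c * t], times
    the measure of the level set. Summing the first bound against the staircase
    gives [X <= l `^ e * A * W + 2 e A c X] for the integral [X] of [u] times the
    staircase. As the staircase is bounded, [X] is finite, and [6 A c e <= 1]
    lets the last term be absorbed. Feeding this into the second bound controls
    the integral of [w] times the staircase without the factor [A], and [w <= u]
    turns the limit of the staircase into [w `^ e]. *)
Lemma self_improvement :
  (\int[mu]_(x in Q) (w x * w x `^ e) <= (3 / 2 * (l `^ e * W))%:E)%E.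
Proof.
pose g n x := (w x * (step n x)%:E)%E.
have mwQ : measurable_fun Q w by exact: measurable_funTS.
have mg n : measurable_fun Q (g n).
  by apply: emeasurable_funM => //; exact: measurable_step.
have g0 n x : Q x -> (0 <= g n x)%E.
  by move=> _; rewrite mule_ge0// lee_fin step_ge0.
have ndg x : {homo g^~ x : n m / (n <= m)%N >-> (n <= m)%E}.
  by move=> n m nm; rewrite lee_wpmul2l// lee_fin step_nd.
have cvg x : cvgn (g^~ x).
  exact/ereal_nondecreasing_is_cvgn/ndg.
apply: (@le_trans _ _ (\int[mu]_(x in Q) limn (g^~ x))%E); last first.
  rewrite monotone_convergence//; apply: lime_le; last by apply: nearW => n; exact: Y_le.
  apply: ereal_nondecreasing_is_cvgn => n m nm.
  by apply: ge0_le_integral => // [x|x] Qx; [exact: g0|exact: ndg].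
apply: ae_ge0_le_integral => //.
- by move=> x _; rewrite mule_ge0// poweR_ge0.
- apply: emeasurable_funM => //.
  apply: (measurableT_comp (measurable_poweR _)) => //.
- move=> x Qx; apply: lime_ge => //; apply: nearW => n; exact: g0.
- by apply: (emeasurable_fun_cvg g) => // x Qx; exact: cvg.
- apply: filterS wu => x /[swap] Qx /(_ Qx) [].
  rewrite -ge0_fin_numE// => wfin wux.
  pose t := fine (w x).
  have t0 : 0 <= t by exact: fine_ge0.
  have wt : w x = t%:E by rewrite fineK.
  have [n tn] : exists n, t <= level n.
    exists (Num.bound (t / l)).
    rewrite -ler_pdivrMr//; apply: ltW; apply: lt_le_trans (archi_boundP _) _.
      by rewrite divr_ge0// ltW.
    by rewrite -natrX ler_nat ltnW// ltn_expl.
  apply: (@le_trans _ _ (g n x)).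
    rewrite /g lee_wpmul2l// wt poweR_EFin lee_fin; apply: step_ge => //.
    by rewrite -wt.
  have := @ereal_nondecreasing_cvgn _ (g^~ x) (ndg x).
  move=> /cvg_lim -> //; apply: ereal_sup_ubound; by exists n.
Qed.

End self_improvement.

(** * Averages, maximal functions and the stopping-time cover *)

Section averages.
Context {R : realType} {S : ptopologicalType} (d : S -> S -> R)
  (mu : {measure set (borel S) -> \bar R}) (kappa : R).
Hypothesis hS : homogeneous_type d mu kappa.

(** The upper level sets of such a supremum are unions of members of the family,
    hence open if these are open: maximal functions are Borel. *)
Lemma above_sup_family (F : set (set S)) (a : set S -> \bar R) (t : \bar R) :
  [set x | (t < ereal_sup [set a B | B in [set B | F B /\ B x]])%E] =
  \bigcup_(B in [set B | F B /\ (t < a B)%E]) B.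
Proof.
apply/seteqP; split=> x /=.
  by move=> /ereal_sup_gt[_ [B [FB Bx] <-] tB]; exists B.
move=> [B [FB tB] Bx]; apply: lt_le_trans tB _.
by apply: ereal_sup_ubound; exists B.
Qed.

Lemma measurable_sup_family (F : set (set S)) (a : set S -> \bar R) :
  (forall B, F B -> open B) ->
  measurable_fun [set: borel S]
    (fun x => ereal_sup [set a B | B in [set B | F B /\ B x]]).
Proof.
move=> oF; apply: emeasurable_funP_gt => r; rewrite above_sup_family.
by apply: measurable_open; apply: bigcup_open => B [/oF].
Qed.

Lemma measurable_maximal f : measurable_fun [set: borel S] (maximal d mu f).
Proof. by apply: measurable_sup_family; exact: (ht_open_ball hS). Qed.

Lemma avg_ge0 B f : (forall x, (0 <= f x)%E) -> (0 <= avg mu B f)%E.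
Proof.
by move=> f0; rewrite mule_ge0 ?inve_ge0 ?integral_ge0.
Qed.

Lemma maximal_ge0 f x : (0 <= maximal d mu f x)%E.
Proof.
apply: (@le_trans _ _ (avg mu (qball d x 1) (fun y => `|f y|%E))).
  by apply: avg_ge0 => y; exact: abse_ge0.
apply: ereal_sup_ubound; exists (qball d x 1) => //.
split; first exact: qballs_qball.
exact: (qball_center (ht_quasimetric hS)).
Qed.

Lemma avg_leE B f t : qballs d B ->
  (avg mu B f <= t%:E)%E = (\int[mu]_(x in B) f x <= t%:E * mu B)%E.
Proof.
move=> hB; move: (mu_qballs_gt0 hS hB) (mu_qballs_fin hS hB).
rewrite /avg; case: (mu B) => // m; rewrite lte_fin => m0 _.
by rewrite inver gt_eqF// lee_pdivrMl// muleC.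
Qed.

Lemma avg_fin_num B f : qballs d B -> (forall x, (0 <= f x)%E) ->
  (\int[mu]_(x in B) f x < +oo)%E -> avg mu B f \is a fin_num.
Proof.
move=> hB f0 foo; have int0 : (0 <= \int[mu]_(x in B) f x)%E by exact: integral_ge0.
move: (mu_qballs_gt0 hS hB) (mu_qballs_fin hS hB).
rewrite /avg; case: (mu B) => // m; rewrite lte_fin => m0 _.
by rewrite inver gt_eqF// fin_numM// ge0_fin_numE.
Qed.

Lemma integral_avg B f : qballs d B -> (forall x, (0 <= f x)%E) ->
  (\int[mu]_(x in B) f x < +oo)%E ->
  (\int[mu]_(x in B) f x = (fine (avg mu B f))%:E * mu B)%E.
Proof.
move=> hB f0 foo; rewrite fineK; last exact: avg_fin_num.
move: (mu_qballs_gt0 hS hB) (mu_qballs_fin hS hB).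
rewrite /avg; case: (mu _) => // m; rewrite lte_fin => m0 _.
by rewrite muleAC inver gt_eqF// -EFinM mulVf ?gt_eqF// mul1e.
Qed.

Lemma le_avg_maximal (w : borel S -> \bar R) (B V : set S) x :
  (forall y, (0 <= w y)%E) -> measurable_fun [set: borel S] w ->
  qballs d V -> V x -> V `<=` B ->
  (avg mu V w <= maximal d mu (fun y => w y * (\1_B y)%:E) x)%E.
Proof.
move=> w0 mw hV Vx VB; apply: ereal_sup_ubound; exists V => //=.
congr (_ * _)%E; apply: eq_integral => y /set_mem /VB By.
by rewrite indicE mem_set// mule1 gee0_abs.
Qed.

End averages.

Section stopping.
Context {R : realType} {S : ptopologicalType} (d : S -> S -> R)
  (mu : {measure set (borel S) -> \bar R}) (kappa : R).
Hypothesis hS : homogeneous_type d mu kappa.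
Variables (w : borel S -> \bar R) (x0 : S) (rho : R).
Hypotheses (mw : measurable_fun [set: borel S] w) (w0 : forall x, (0 <= w x)%E)
  (rho0 : 0 < rho).
Local Notation theta := (4 * kappa ^+ 2 + kappa).
Local Notation D := (doubling_order d mu).
Local Notation ball c := (qball d c.1 c.2).
Local Notation hQ := (qball d x0 (2 * kappa * rho)).

Definition small_balls : set (S * R) :=
  [set c | [/\ qball d x0 rho c.1, 0 < c.2 & c.2 <= rho]].

(** The outer [maxe 0] makes the value [0], and not [-oo], at points that no
    admissible ball contains. *)
Definition local_maximal (x : S) : \bar R :=
  maxe 0%E (ereal_sup [set avg mu B w | B in
    [set B | [set ball c | c in small_balls] B /\ B x]]).

(** With [B] the ball of centre [x0] and radius [rho], the factor bounds the ratio
    of the measures of [2 kappa B] and of any ball of radius [rho] centred in [B],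
    so that above this level no ball of maximal radius is selected. *)
Definition stopping_level : R :=
  (4 * kappa ^+ 2 + 2 * kappa) `^ D * fine (avg mu hQ w).

(** A dilate that may leave [2 kappa B] is replaced by [2 kappa B] itself: it
    still contains every admissible ball, and averages over it stay under
    control. *)
Definition enlargement (c : S * R) : set S :=
  if theta * c.2 <= rho then qball d c.1 (theta * c.2) else hQ.

Let qd : quasimetric d kappa. Proof. exact: ht_quasimetric hS. Qed.

Let hQ_qballs : qballs d hQ.
Proof. by have k1 := kappa_ge1 hS; apply: qballs_qball; rewrite !mulr_gt0//; lra. Qed.

Let small_qballs c : small_balls c -> qballs d (ball c).
Proof. by case=> _ ? _; exact: qballs_qball. Qed.

Lemma small_balls_sub c : small_balls c -> ball c `<=` hQ.
Proof.
have k1 := kappa_ge1 hS; move=> [cQ c0 crho]; apply: subset_trans (qball_enlarge qd cQ) _.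
by apply: le_qball; nra.
Qed.

Lemma enlargement_qballs c : small_balls c -> qballs d (enlargement c).
Proof.
have k1 := kappa_ge1 hS; move=> [_ c0 _]; rewrite /enlargement; case: ifP => // _.
by apply: qballs_qball; rewrite mulr_gt0//; nra.
Qed.

Lemma sub_enlargement b c : small_balls b ->
  ball b `<=` qball d c.1 (theta * c.2) -> ball b `<=` enlargement c.
Proof.
by rewrite /enlargement; case: ifP => // _ /small_balls_sub.
Qed.

Lemma local_maximal_ge0 x : (0 <= local_maximal x)%E.
Proof. by rewrite le_max lexx. Qed.

Lemma measurable_local_maximal : measurable_fun [set: borel S] local_maximal.
Proof.
apply: measurable_maxe; first exact: measurable_cst.
by apply: measurable_sup_family => _ [c /small_qballs h <-]; exact: (ht_open_ball hS h).
Qed.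

Lemma above_local_maximal t : 0 <= t ->
  [set x | (t%:E < local_maximal x)%E] =
  \bigcup_(c in [set c | small_balls c /\ (t%:E < avg mu (ball c) w)%E]) ball c.
Proof.
move=> t0; rewrite (_ : [set x | _] = [set x | (t%:E < ereal_sup
    [set avg mu B w | B in [set B | [set ball c | c in small_balls] B /\ B x]])%E]).
  rewrite above_sup_family; apply/seteqP; split=> x.
    by move=> [_ [[c sc <-] tc] xc]; exists c.
  by move=> [c [sc tc] xc]; exists (ball c) => //; split => //; exists c.
by apply/seteqP; split=> x /=; rewrite /local_maximal lt_max ltNge lee_fin t0.
Qed.

Lemma local_maximal_le x (t : \bar R) : (0 <= t)%E ->
  (forall c, small_balls c -> ball c x -> (avg mu (ball c) w <= t)%E) ->
  (local_maximal x <= t)%E.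
Proof.
move=> t0 H; rewrite /local_maximal ge_max t0 /=; apply: ge_ereal_sup.
by move=> _ [_ [[c sc <-] xc] <-]; exact: H.
Qed.

Lemma le_local_maximal c x : small_balls c -> ball c x ->
  (avg mu (ball c) w <= local_maximal x)%E.
Proof.
move=> sc cx; rewrite /local_maximal le_max; apply/orP; right.
by apply: ereal_sup_ubound; exists (ball c) => //; split => //; exists c.
Qed.

Hypothesis (wfin : forall B, qballs d B -> (\int[mu]_(x in B) w x < +oo)%E).

Let int_hQ : (\int[mu]_(x in hQ) w x = (fine (avg mu hQ w))%:E * mu hQ)%E.
Proof. by apply: (integral_avg hS) => //; exact: wfin. Qed.

(** Above the stopping level each ball with large average lies in a concentric one
    whose radius exceeds half the supremum of the radii with large average. Its
    dilate by [theta >= 5] is then beyond that supremum and has average at most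
    [t], or else it is so large that the definition of the stopping level
    applies. *)
Lemma enlargement_le t b : stopping_level <= t -> small_balls b ->
    (t%:E < avg mu (ball b) w)%E ->
  exists c, [/\ small_balls c, (t%:E < avg mu (ball c) w)%E,
    ball b `<=` ball c &
    (\int[mu]_(x in enlargement c) w x <= t%:E * mu (qball d c.1 (theta * c.2)))%E].
Proof.
have k1 := kappa_ge1 hS; have r1 := rho0; move=> lt sb tb.
case: b sb tb => z r sb tb; have [/= zQ r0 rrho] := sb.
pose A := [set s | small_balls (z, s) /\ (t%:E < avg mu (qball d z s) w)%E].
have Ar : A r by [].
have supA : has_sup A.
  split; first by exists r.
  by exists rho => s [[]].
have ub s : A s -> s <= sup A by move=> As; apply: sup_upper_bound.
have A0 : 0 < sup A by exact: lt_le_trans (ub _ Ar).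
have [s' As' s'A] := @sup_adherent _ A (sup A / 2) ltac:(lra) supA.
pose s := Num.max r s'.
have As : A s by rewrite /s; case: leP.
have sA : sup A < 2 * s.
  have : s' <= s by rewrite /s le_max lexx orbT.
  lra.
have rs : r <= s by rewrite /s le_max lexx.
exists (z, s); have [ss ts] := As; split => //=; first exact: le_qball.
have th5 : 5 <= theta by nra.
have s0 : 0 < s by lra.
rewrite /enlargement /=; case: ifPn => ths.
- rewrite -(avg_leE hS); last by apply: qballs_qball; rewrite mulr_gt0//; lra.
  rewrite leNgt; apply/negP => tth.
  have : A (theta * s) by split => //; split => //=; rewrite mulr_gt0//; lra.
  by move/ub; nra.
- rewrite int_hQ.
  have sub : hQ `<=` qball d z (kappa * (1 + 2 * kappa) * rho).
    apply: subset_trans (qball_enlarge qd (qball_sym qd zQ)) _.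
    by apply: le_qball; nra.
  have mhQ : (mu hQ <= ((4 * kappa ^+ 2 + 2 * kappa) `^ D)%:E * mu (qball d z rho))%E.
    apply: (@le_trans _ _ (mu (qball d z (kappa * (1 + 2 * kappa) * rho)))).
      apply: le_measure; rewrite ?inE//; first exact: (measurable_qballs hS).
      by apply: (measurable_qball hS); rewrite !mulr_gt0//; lra.
    apply: le_trans (mu_qball_scale hS _ _ _) _ => //; first nra.
    by rewrite (_ : 2 * (kappa * (1 + 2 * kappa)) = 4 * kappa ^+ 2 + 2 * kappa)//; ring.
  have a0 : 0 <= fine (avg mu hQ w) by rewrite fine_ge0// avg_ge0.
  apply: (@le_trans _ _ (stopping_level%:E * mu (qball d z rho))%E).
    rewrite /stopping_level [in leRHS]EFinM -muleA muleCA.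
    exact: lee_wpmul2l.
  apply: lee_pmul => //; first by rewrite lee_fin mulr_ge0// powR_ge0.
  apply: le_measure; rewrite ?inE; first exact: (measurable_qball hS).
  - by apply: (measurable_qball hS); rewrite mulr_gt0//; lra.
  - by apply: le_qball; rewrite -ltNge in ths; exact: ltW.
Qed.

(** The Calderon-Zygmund covering at height [t]: Vitali's lemma applied to the
    balls produced by [enlargement_le]. *)
Lemma stopping_cover t : stopping_level <= t ->
  exists (I : set nat) (c : nat -> S * R), [/\
    (forall i, I i -> small_balls (c i) /\ (t%:E < avg mu (ball (c i)) w)%E),
    trivIset I (fun i => ball (c i)),
    (forall b, small_balls b -> (t%:E < avg mu (ball b) w)%E ->
      exists2 i, I i & ball b `<=` enlargement (c i)) &
    (forall i, I i -> (\int[mu]_(x in enlargement (c i)) w x <=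
      ((2 * theta) `^ D * t)%:E * mu (ball (c i)))%E)].
Proof.
have k1 := kappa_ge1 hS; move=> lt.
have t0 : 0 <= t.
  apply: le_trans lt; rewrite mulr_ge0 ?powR_ge0// fine_ge0//.
  exact: avg_ge0.
pose F := [set c | [/\ small_balls c, (t%:E < avg mu (ball c) w)%E &
    (\int[mu]_(x in enlargement c) w x <= t%:E * mu (qball d c.1 (theta * c.2)))%E]].
have [G [GF tG FG]] : exists G : set (S * R), [/\ G `<=` F,
    trivIset G (fun c => ball c) &
    forall c, F c -> exists2 g, G g & ball c `<=` qball d g.1 (theta * g.2)].
  by apply: (vitali_covering qd (rho := rho)) => c [[_ -> ->]].
have : countable G.
  apply: (@countable_trivIset_gt0 _ _ _ mu _ G (fun c => ball c) hQ) => //.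
  - exact: (measurable_qballs hS).
  - by case/andP: (ht_ball_measure hS hQ_qballs).
  - move=> c /GF[sc _ _]; have bc := small_qballs sc; split.
    + exact: (measurable_qballs hS).
    + exact: (mu_qballs_gt0 hS).
    + exact: small_balls_sub.
move=> /countable_bijP[I]; rewrite card_eq_sym => /pcard_eqP/bijPex[/= c bij].
have IG i : I i -> G (c i) by move=> Ii; apply: (set_bij_sub bij); exists i.
exists I, c; split.
- by move=> i /IG/GF[].
- move=> i j Ii Ij ij; apply: (set_bij_inj bij); rewrite ?inE//.
  by apply: tG => //; exact: IG.
- move=> b sb tb; have [b' [sb' tb' bb' eb']] := enlargement_le lt sb tb.
  have [g Gg b'g] := FG b' (And3 sb' tb' eb').
  have [i Ii ig] := set_bij_surj bij Gg.
  exists i => //; rewrite ig; apply: sub_enlargement => //.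
  exact: subset_trans b'g.
- move=> i /IG/GF[[_ ci0 _] _ /le_trans]; apply.
  rewrite [in leRHS]EFinM -muleA muleCA; apply: lee_wpmul2l => //.
  by apply: (mu_qball_scale hS) => //; nra.
Qed.

End stopping.

(** * The reverse Hoelder inequality *)

(** The final constants: [3 / 2] comes from the self-improvement step and [7 / 6]
    from the stopping level raised to the small power [e]; their product [7 / 4]
    is below the [2] of the reverse Hoelder constant. *)
Lemma reverse_hoelder_constant {R : realType} (cm a e K M m : R) : 0 <= cm -> 0 < a -> 0 <= e ->
  cm `^ e <= 7 / 6 -> 1 <= K -> M <= K * m -> 0 <= M ->
  3 / 2 * ((cm * a) `^ e * (a * M)) <= (2 * K * a) `^ (1 + e) * m.
Proof.
move=> cm0 a0 e0 cme K1 MK M0.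
have m0 : 0 <= m by rewrite -(@pmulr_rge0 _ K)//; lra.
have a_0 : 0 <= a by exact: ltW.
rewrite [in leRHS]powRM ?(powRM _ cm0)//; last by lra.
have -> : a `^ (1 + e) = a * a `^ e by rewrite powRD ?powRr1//; apply/implyP => /eqP; lra.
have K2 : 2 * K <= (2 * K) `^ (1 + e).
  rewrite -[leLHS]powRr1; last by lra.
  by apply: ler_powR; lra.
have ae := powR_ge0 a e.
set p := a `^ e in ae *; set q := cm `^ e in cme *.
set k := (2 * K) `^ _ in K2 *.
have p1 : q * (p * a * M) <= 7 / 6 * (p * a * M) by rewrite ler_wpM2r// !mulr_ge0.
have p2 : p * a * M <= p * a * (K * m) by rewrite ler_wpM2l// mulr_ge0.
have p3 : 2 * K * (p * a * m) <= k * (p * a * m) by rewrite ler_wpM2r// !mulr_ge0.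
have p4 : 0 <= K * (p * a * m) by rewrite !mulr_ge0//; lra.
lra.
Qed.

Section reverse_hoelder.
Context {R : realType} {S : ptopologicalType} (d : S -> S -> R)
  (mu : {measure set (borel S) -> \bar R}) (kappa : R).
Hypothesis hS : homogeneous_type d mu kappa.
Variables (w : borel S -> \bar R) (A : R).
Hypotheses (mw : measurable_fun [set: borel S] w) (w0 : forall x, (0 <= w x)%E)
  (wfin : forall B, qballs d B -> (0 < \int[mu]_(x in B) w x < +oo)%E)
  (A1 : 1 <= A)
  (hA : forall B, qballs d B ->
    (\int[mu]_(x in B) maximal d mu (fun y => w y * (\1_B y)%:E) x <=
     A%:E * \int[mu]_(x in B) w x)%E).
Local Notation theta := (4 * kappa ^+ 2 + kappa).
Local Notation D := (doubling_order d mu).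
Local Notation ball c := (qball d c.1 c.2).

Section local.
Variables (x0 : S) (rho : R).
Hypothesis rho0 : 0 < rho.
Local Notation hQ := (qball d x0 (2 * kappa * rho)).
Local Notation Q := (qball d x0 rho).
Local Notation u := (local_maximal d mu w x0 rho).
Local Notation L := (stopping_level d mu kappa w x0 rho).

Let wlty B : qballs d B -> (\int[mu]_(x in B) w x < +oo)%E.
Proof. by move=> /wfin/andP[]. Qed.

Let u0 x : (0 <= u x)%E. Proof. exact: local_maximal_ge0. Qed.

Let hQ_qballs : qballs d hQ.
Proof.
by have k1 := kappa_ge1 hS; have r := rho0; apply: qballs_qball; rewrite !mulr_gt0//; lra.
Qed.

Let Q_qballs : qballs d Q. Proof. exact: qballs_qball. Qed.

Let L_ge0 : 0 <= L.
Proof. by rewrite mulr_ge0 ?powR_ge0// fine_ge0// avg_ge0. Qed.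

Let mu_above t : 0 <= t -> measurable [set x : borel S | (t%:E < u x)%E].
Proof.
move=> t0; rewrite -[X in measurable X]setTI.
by apply: emeasurable_fun_o_infty => //; exact: (measurable_local_maximal hS).
Qed.

Let sum_mu_le t (I : set nat) (c : nat -> S * R) : 0 <= t ->
  (forall i, I i -> small_balls d x0 rho (c i) /\
    (t%:E < avg mu (ball (c i)) w)%E) ->
  trivIset I (fun i => ball (c i)) ->
  (\sum_(i <oo | i \in I) mu (ball (c i)) <= mu [set x | (t%:E < u x)%E])%E.
Proof.
move=> t0 Ic tc.
have mc i : I i -> measurable (ball (c i) : set (borel S)).
  by move=> /Ic[[_ ? _] _]; exact: (measurable_qball hS).
rewrite -measure_bigcup//.
apply: le_measure; rewrite ?inE; [exact: bigcup_measurable|exact: mu_above|].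
rewrite above_local_maximal// => x [i Ii xi].
by exists (c i) => //; exact: Ic.
Qed.

(** Every admissible ball with average above [t] lies in one enlargement [B i], so
    its average is at most the maximal function of [w] restricted to [B i]. Hence
    on the level set the local maximal function is at most the sum of these
    localized maximal functions, and the [A_infty] condition on each [B i]
    applies. *)
Lemma integral_local_maximal_above t : L <= t ->
  (\int[mu]_(x in [set x | (t%:E < u x)%E]) u x <=
   (A * (2 * theta) `^ D * t)%:E * mu [set x | (t%:E < u x)%E])%E.
Proof.
move=> Lt; have t0 : 0 <= t by exact: le_trans Lt.
have [I [c [Ic tc cov intc]]] := stopping_cover hS w0 rho0 wlty Lt.
pose B i := enlargement d kappa x0 rho (c i).
have qB i : I i -> qballs d (B i).
  by move=> /Ic[sc _]; exact: (enlargement_qballs hS).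
pose g i := maximal d mu (fun y => w y * (\1_(B i) y)%:E)%E.
have g0 i x : (0 <= g i x)%E by exact: (maximal_ge0 hS).
have gB0 i x : (0 <= (g i \_ (B i)) x)%E by rewrite /patch; case: ifP.
have pw b x : small_balls d x0 rho b -> ball b x -> (t%:E < avg mu (ball b) w)%E ->
    (avg mu (ball b) w <= \sum_(i <oo | i \in I) (g i \_ (B i)) x)%E.
  move=> sb bx tb; have [i Ii bi] := cov _ sb tb.
  apply: le_trans (nneseries_term_le Ii (fun k => gB0 k x)).
  rewrite patchT; last by rewrite inE; exact: bi.
  by apply: le_avg_maximal => //; case: sb => _ ? _; exact: qballs_qball.
apply: (@le_trans _ _ (\sum_(i <oo | i \in I) \int[mu]_(x in B i) g i x)%E).
  apply: integral_cover => //.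
  - exact: mu_above.
  - by apply: measurable_funTS; exact: (measurable_local_maximal hS).
  - by move=> i /qB; exact: (measurable_qballs hS).
  - by move=> i; exact: (measurable_maximal hS).
  move=> x; rewrite above_local_maximal// => -[b' [sb' tb'] b'x].
  apply: local_maximal_le; first exact: nneseries_ge0.
  move=> b sb bx; have [tb|bt] := ltP t%:E (avg mu (ball b) w); first exact: pw.
  by rewrite (le_trans bt)// (le_trans (ltW tb'))// pw.
apply: (@le_trans _ _ (\sum_(i <oo | i \in I)
    (A * (2 * theta) `^ D * t)%:E * mu (ball (c i)))%E).
  apply: lee_nneseries => [i _ _|i /set_mem Ii]; first exact: integral_ge0.
  apply: le_trans (hA (qB _ Ii)) _.
  rewrite -mulrA EFinM -muleA; apply: lee_wpmul2l; last exact: intc.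
  by rewrite lee_fin (le_trans ler01).
rewrite nneseriesZl//; apply: lee_wpmul2l; last exact: sum_mu_le.
by rewrite lee_fin !mulr_ge0// ?powR_ge0// (le_trans ler01).
Qed.

Lemma integral_weight_above t : L <= t ->
  (\int[mu]_(x in Q `&` [set x | (t%:E < u x)%E]) w x <=
   ((2 * theta) `^ D * t)%:E * mu [set x | (t%:E < u x)%E])%E.
Proof.
move=> Lt; have t0 : 0 <= t by exact: le_trans Lt.
have [I [c [Ic tc cov intc]]] := stopping_cover hS w0 rho0 wlty Lt.
pose B i := enlargement d kappa x0 rho (c i).
have qB i : I i -> qballs d (B i).
  by move=> /Ic[sc _]; exact: (enlargement_qballs hS).
apply: (@le_trans _ _ (\sum_(i <oo | i \in I) \int[mu]_(x in B i) w x)%E).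
  have := @integral_cover _ _ _ mu w (Q `&` [set x | (t%:E < u x)%E]) I B (fun=> w).
  apply => //.
  - apply: measurableI; first exact: (measurable_qball hS).
    exact: mu_above.
  - exact: measurable_funTS.
  - by move=> i /qB; exact: (measurable_qballs hS).
  move=> x [_]; rewrite above_local_maximal// => -[b [sb tb] bx].
  have [i Ii bi] := cov _ sb tb.
  have F0 k : (0 <= (w \_ (B k)) x)%E by rewrite /patch; case: ifP.
  apply: le_trans (nneseries_term_le Ii F0).
  by rewrite patchT// inE; exact: bi.
apply: (@le_trans _ _ (\sum_(i <oo | i \in I)
    ((2 * theta) `^ D * t)%:E * mu (ball (c i)))%E).
  apply: lee_nneseries => [i _ _|i /set_mem Ii]; first exact: integral_ge0.
  exact: intc.
rewrite nneseriesZl//; apply: lee_wpmul2l; last exact: sum_mu_le.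
by rewrite lee_fin mulr_ge0// powR_ge0.
Qed.

Lemma integral_local_maximal :
  (\int[mu]_x u x <= A%:E * \int[mu]_(x in hQ) w x)%E.
Proof.
have mhQ : measurable (hQ : set (borel S)) by exact: (measurable_qballs hS).
apply: le_trans (hA hQ_qballs).
rewrite [leRHS]integral_mkcond; apply: ge0_le_integral => //.
- exact: (measurable_local_maximal hS).
- apply/(measurable_restrictT _ mhQ).
  by apply: measurable_funTS; exact: (measurable_maximal hS).
move=> x _; apply: local_maximal_le.
  by rewrite /patch; case: ifP => // _; exact: (maximal_ge0 hS).
move=> b sb bx; have bhQ := small_balls_sub hS sb.
rewrite patchT; last by rewrite inE; exact: bhQ.
by apply: le_avg_maximal => //; case: sb => _ ? _; exact: qballs_qball.
Qed.

(** The differentiation hypothesis concerns real functions, so it is applied to the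
    finite part of [w]. That function is at most [w] everywhere, which is enough
    for the averages, and equals [w] almost everywhere on [Q]. *)
Lemma le_local_maximal_ae :
  {ae mu, forall x, Q x -> (w x < +oo)%E /\ (w x <= u x)%E}.
Proof.
have fw x : ((fine (w x))%:E <= w x)%E.
  by move: (w0 x); case: (w x) => // _; exact: leey.
have mfw : measurable_fun [set: borel S] (fun x => (fine (w x))%:E).
  by apply/measurable_EFinP; exact: measurableT_comp.
have intw B : qballs d B -> mu.-integrable B (fun x => (fine (w x))%:E).
  move=> hB; apply/integrableP; split; first exact: measurable_funTS.
  apply: le_lt_trans (wlty hB); apply: ge0_le_integral => //.
  - exact: (measurable_qballs hS).
  - by apply: measurable_funTS; exact: measurableT_comp.
  - exact: measurable_funTS.
  - by move=> x _; rewrite gee0_abs// lee_fin fine_ge0.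
have wae : {ae mu, forall x, Q x -> w x \is a fin_num}.
  apply: integrable_ae; first exact: (measurable_qball hS).
  apply/integrableP; split; first exact: measurable_funTS.
  by under eq_integral do rewrite gee0_abs//; exact: wlty.
have /(_ (fun x => fine (w x))) := ht_lebesgue hS.
move=> /(_ intw) lae.
have aeF : Filter (almost_everywhere mu) := ae_filter_ringOfSetsType mu.
apply: (@filterS2 _ _ aeF _ _ _ _ wae lae) => x wx lx Qx.
have wxfin := wx Qx; split; first by rewrite -ge0_fin_numE.
rewrite -(fineK wxfin) -(cvg_lim _ lx)//; apply: lime_le; first by apply/cvg_ex; eexists; exact: lx.
near=> r.
have r0 : 0 < r by near: r; exact: nbhs_right_gt.
have rrho : r <= rho by near: r; exact: nbhs_right_le.
apply: (@le_trans _ _ (avg mu (qball d x r) w)).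
  rewrite /avg; apply: lee_wpmul2l; first by rewrite inve_ge0.
  apply: ge0_le_integral => //.
  - exact: (measurable_qball hS).
  - by move=> y _; rewrite lee_fin fine_ge0.
  - exact: measurable_funTS.
  - exact: measurable_funTS.
- by move=> y _; exact: fw.
exact: (@le_local_maximal _ _ d mu w x0 rho (x, r) x (And3 Qx r0 rrho)
  (qball_center (ht_quasimetric hS) x r0)).
Unshelve. all: by end_near. Qed.

Local Notation T := ((32 * kappa ^+ 2 * theta ^+ 2) `^ D).
Local Notation a := (fine (avg mu hQ w)).

Let a_gt0 : 0 < a.
Proof.
have /andP[i0 ioo] := wfin hQ_qballs.
rewrite fine_gt0// -ge0_fin_numE; last exact: avg_ge0.
rewrite (avg_fin_num hS)// andbT.
have := mu_qballs_gt0 hS hQ_qballs; have := mu_qballs_fin hS hQ_qballs.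
rewrite /avg; case: (mu _) => // m _; rewrite lte_fin => m0.
by rewrite inver gt_eqF// mule_gt0// lte_fin invr_gt0.
Qed.

(** The reverse Hoelder inequality with exponent [1 + e], over [Q] against the
    average over [2 kappa Q]. All constants produced by the covering argument are
    at most [T], so the smallness condition on [e] both permits absorption and
    keeps [T `^ e] close to 1. *)
Lemma reverse_hoelder e : 0 <= e -> 6 * (A * T) * e <= 1 ->
  (\int[mu]_(x in Q) (w x * w x `^ e) <=
   ((2 * (4 * kappa) `^ D * a) `^ (1 + e))%:E * mu Q)%E.
Proof.
have k1 := kappa_ge1 hS; have D0 := doubling_order_ge0 hS; have A1' := A1.
move=> e0 ATe.
have k2 : 1 <= kappa ^+ 2 by rewrite exprn_ege1.
have th1 : 1 <= theta by lra.
have th2 : theta <= theta ^+ 2 by rewrite expr2 ler_peMl//; lra.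
have powle x y : 0 <= x -> x <= y -> x `^ D <= y `^ D.
  by move=> x_ge0 xy; apply: ge0_ler_powR; rewrite ?nnegrE//; exact: le_trans xy.
have powge1 x : 1 <= x -> 1 <= x `^ D.
  by move=> x1; have := powle 1 x ler01 x1; rewrite powR1.
have T1 : 1 <= T by apply: powge1; nra.
have cT : (2 * theta) `^ D <= T by apply: powle; nra.
have mT : (4 * kappa ^+ 2 + 2 * kappa) `^ D <= T by apply: powle; nra.
have Te : T * e <= 1 / 6.
  have : 1 * (T * e) <= A * (T * e) by rewrite ler_wpM2r// mulr_ge0//; lra.
  lra.
have e1 : e <= 1.
  have : 1 * e <= T * e by rewrite ler_wpM2r.
  lra.
(* By Bernoulli's inequality, since [T * e <= 1 / 6]. *)
have Te76 : T `^ e <= 7 / 6.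
  apply: le_trans (powR_le_affine _ _) _; [lra|by rewrite e0|lra].
have qQ := Q_qballs; have a0 := a_gt0.
have ae : (\int[mu]_(x in hQ) w x = a%:E * mu hQ)%E.
  by apply: (integral_avg hS) => //; exact: wlty.
have mhQ := mu_qballs_fin hS hQ_qballs.
have mQ := mu_qballs_fin hS qQ.
have M0 : 0 <= fine (mu hQ) by rewrite fine_ge0.
have MK : fine (mu hQ) <= (4 * kappa) `^ D * fine (mu Q).
  rewrite -lee_fin EFinM !fineK//.
  apply: le_trans (mu_qball_scale hS _ rho0 _) _; first lra.
  by rewrite (_ : 2 * (2 * kappa) = 4 * kappa)//; ring.
have Ace : 6 * (A * (2 * theta) `^ D) * e <= 1.
  apply: le_trans ATe; rewrite ler_wpM2r// ler_wpM2l// ler_wpM2l//.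
  lra.
have L0 : 0 < L by rewrite mulr_gt0// powR_gt0//; nra.
have aM0 : 0 <= a * fine (mu hQ) by rewrite mulr_ge0// ltW.
have intu : (\int[mu]_x u x <= (A * (a * fine (mu hQ)))%:E)%E.
  by rewrite !EFinM (fineK mhQ) -ae; exact: integral_local_maximal.
have intw : (\int[mu]_(x in Q) w x <= (a * fine (mu hQ))%:E)%E.
  rewrite EFinM (fineK mhQ) -ae; apply: ge0_subset_integral => //.
  - exact: (measurable_qballs hS).
  - exact: (measurable_qballs hS).
  - exact: measurable_funTS.
  - apply: le_qball; have rh := rho0.
    by have : 1 * rho <= kappa * rho; [rewrite ler_pM2r|lra].
apply: le_trans (self_improvement _ (measurable_local_maximal hS w x0 rho) u0 mw w0 L0 e0 e1
  (powR_ge0 _ _) _ aM0 Ace intu intw integral_local_maximal_above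
  integral_weight_above le_local_maximal_ae) _.
- exact: (measurable_qballs hS).
- lra.
rewrite -(fineK mQ) -EFinM lee_fin.
apply: (@reverse_hoelder_constant _ ((4 * kappa ^+ 2 + 2 * kappa) `^ D) a e ((4 * kappa) `^ D)
  (fine (mu hQ)) (fine (mu Q)) (powR_ge0 _ _) a0 e0 _ _ MK M0).
- by apply: le_trans Te76; apply: ge0_ler_powR; rewrite ?nnegrE ?powR_ge0.
- by apply: powge1; lra.
Qed.

End local.
End reverse_hoelder.

(** * The dual weight of an A_p weight *)

Section epow.
Context {R : realType}.
Implicit Types (x : \bar R) (s : R).

Lemma epow_ge0 x s : (0 <= x)%E -> (0 <= epow x s)%E.
Proof. by move=> x0; rewrite /epow; case: ifP; rewrite ?inve_ge0 poweR_ge0. Qed.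

Lemma epow_gt0 x s : s < 0 -> (0 <= x < +oo)%E -> (0 < epow x s)%E.
Proof.
move=> s0 /andP[x0 xoo]; rewrite /epow s0.
have : (x `^ (- s) != +oo)%E by rewrite -ltey; exact: poweR_lty.
have := poweR_ge0 x (- s); case: (x `^ _)%E => // r; rewrite lee_fin => r0 _.
rewrite inver; case: ifPn => // rn0; rewrite lte_fin invr_gt0 lt_def rn0//.
Qed.

(** The conventions for zero and infinity are preserved by positive powers. *)
Lemma epowM x s r : (0 <= x)%E -> s < 0 -> 0 < r -> epow x (s * r) = (epow x s `^ r)%E.
Proof.
move=> x0 s0 r0; rewrite /epow s0 pmulr_llt0// s0 -mulNr poweRrM.
have := poweR_ge0 x (- s); case: (x `^ _)%E => // [t|_].
  rewrite lee_fin le_eqVlt => /predU1P[<-|t0].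
    by rewrite poweR0r ?gt_eqF// inve0 poweRyr// gt_eqF.
  rewrite poweR_EFin !inver !gt_eqF ?powR_gt0// poweR_EFin; congr EFin.
  by rewrite -(powR_inv1 (ltW t0)) -powRrM mulN1r powRN.
by rewrite poweRyr ?gt_eqF// invey poweR0r// gt_eqF.
Qed.

(** For negative exponents, inversion exchanges upper and lower level sets. *)
Lemma measurable_epow {dd} {T : measurableType dd} (w : T -> \bar R) s :
  measurable_fun [set: T] w -> (forall x : T, (0 <= w x)%E) ->
  measurable_fun [set: T] (fun x : T => epow (w x) s).
Proof.
move=> mw w0; rewrite /epow; case: ltP => s0; last first.
  exact: (measurableT_comp (measurable_poweR _)).
apply: emeasurable_funP_gt => r.
have mp : measurable_fun [set: T] (fun x : T => w x `^ (- s))%E.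
  exact: (measurableT_comp (measurable_poweR _)).
have [r0|r0] := ltP r 0.
  rewrite (_ : [set x : T | _] = setT)//; apply/seteqP; split=> // x _ /=.
  by apply: (@lt_le_trans _ _ 0%E); rewrite ?lte_fin// inve_ge0 poweR_ge0.
rewrite (_ : [set x : T | _] = setT `&` [set x : T | (w x `^ (- s) < r%:E^-1)%E]).
  exact: emeasurable_fun_infty_o.
rewrite setTI; apply/seteqP; split=> x /=;
  by rewrite inve_pgt// ?inE ?lee_fin ?poweR_ge0.
Qed.

End epow.

Section dual_weight.
Context {R : realType} {S : ptopologicalType} (d : S -> S -> R)
  (mu : {measure set (borel S) -> \bar R}) (kappa : R).
Hypothesis hS : homogeneous_type d mu kappa.
Variables (p : R) (w : borel S -> \bar R).
Hypothesis hw : in_Aq d mu p w.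
Let sigma x := epow (w x) (- (p - 1)^-1).

Let p1 : 1 < p. Proof. by case: hw. Qed.
Let mw : measurable_fun [set: borel S] w. Proof. by case: hw => _ []. Qed.
Let w0 x : (0 <= w x)%E. Proof. by case: hw => _ []. Qed.

Lemma dual_weight_measurable : measurable_fun [set: borel S] sigma.
Proof. exact: measurable_epow. Qed.

Lemma dual_weight_ge0 x : (0 <= sigma x)%E.
Proof. exact: epow_ge0. Qed.

Lemma integral_lty B f : qballs d B -> (forall x, (0 <= f x)%E) ->
  (avg mu B f < +oo)%E -> (\int[mu]_(x in B) f x < +oo)%E.
Proof.
move=> hB f0; have := avg_ge0 mu B f0.
case E : (avg mu B f) => [a| |] // _ _.
have := lexx (a%:E : \bar R); rewrite -{1}E (avg_leE hS)// => /le_lt_trans; apply.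
by rewrite -(fineK (mu_qballs_fin hS hB)) -EFinM ltry.
Qed.

Lemma Aq_avg_lty B : qballs d B ->
  (avg mu B w < +oo)%E /\ (avg mu B sigma < +oo)%E.
Proof.
move=> hB; have [_ _ Aoo] := hw.
have : (mule_infty (avg mu B w) (avg mu B sigma `^ (p - 1)) < +oo)%E.
  by apply: le_lt_trans Aoo; apply: ereal_sup_ubound; exists B.
rewrite /mule_infty; case: ifPn => //; rewrite negb_or -!ltey => /andP[-> s _].
by split => //; apply: lty_poweRy s; rewrite gt_eqF// subr_gt0.
Qed.

Lemma Aq_integral_lty B : qballs d B ->
  (\int[mu]_(x in B) w x < +oo)%E /\ (\int[mu]_(x in B) sigma x < +oo)%E.
Proof.
move=> hB; have [wB sB] := Aq_avg_lty hB.
by split; apply: integral_lty => //; exact: dual_weight_ge0.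
Qed.

(** The dual weight vanishes only where [w] is infinite, which is a null set since
    [w] is locally integrable. *)
Lemma dual_weight_integral_gt0 B : qballs d B ->
  (0 < \int[mu]_(x in B) sigma x)%E.
Proof.
move=> hB; have [wB _] := Aq_integral_lty hB.
have mB := measurable_qballs hS hB.
rewrite lt_def integral_ge0 ?andbT; last by move=> x _; exact: dual_weight_ge0.
apply/negP => /eqP s0.
have sae : ae_eq mu B sigma (cst 0%E).
  apply/ae_eq_integral_abs => //.
    by apply: measurable_funTS; exact: dual_weight_measurable.
  by under eq_integral do rewrite gee0_abs ?dual_weight_ge0//.
have wae : {ae mu, forall x, B x -> w x \is a fin_num}.
  apply: integrable_ae => //; apply/integrableP; split; first exact: measurable_funTS.
  by under eq_integral do rewrite gee0_abs//.
have aeF : Filter (almost_everywhere mu) := ae_filter_ringOfSetsType mu.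
have : almost_everywhere mu (~` B).
  apply: (@filterS2 _ _ aeF _ _ _ _ wae sae) => x wx sx Bx.
  have : (0 < sigma x)%E.
    by apply: epow_gt0; rewrite ?oppr_lt0 ?invr_gt0 ?subr_gt0// w0 -ge0_fin_numE ?wx.
  by rewrite sx// ltxx.
rewrite /almost_everywhere => nB; have := mu_qballs_gt0 hS hB.
rewrite (_ : mu B = 0%E) ?ltxx//; apply: measure_negligible => //.
by apply: negligibleS nB => x Bx; exact.
Qed.

(** On a ball [B] the maximal function of [sigma] restricted to [B] is at least the
    average of [sigma] over [B]. *)
Lemma Ainfty_dual_ge1 : (1 <= Ainfty_constant d mu sigma)%E.
Proof.
have hB : qballs d (qball d point 1) by exact: qballs_qball.
have mB := measurable_qballs hS hB.
have [_ soo] := Aq_integral_lty hB; have s0 := dual_weight_integral_gt0 hB.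
apply: le_trans (ereal_sup_ubound _); last by exists (qball d point 1).
set B := qball d point 1 in hB mB soo s0 *.
have : (\int[mu]_(x in B) sigma x <=
    \int[mu]_(x in B) maximal d mu (fun y => sigma y * (\1_B y)%:E)%E x)%E.
  rewrite (integral_avg hS hB dual_weight_ge0 soo) fineK; last first.
    exact: (avg_fin_num hS hB dual_weight_ge0 soo).
  rewrite -integral_cst//; apply: ge0_le_integral => //.
  - by move=> x _; exact: avg_ge0 dual_weight_ge0.
  - by apply: measurable_funTS; exact: (measurable_maximal hS).
  - move=> x Bx; apply: le_avg_maximal => //.
    + exact: dual_weight_ge0.
    + exact: dual_weight_measurable.
move: s0 soo; case: (\int[mu]_(x in B) sigma x)%E => // i; rewrite lte_fin => i0 _ iX.
by rewrite inver gt_eqF// lee_pdivlMl// mule1.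
Qed.

Lemma Ainfty_dual_le B : qballs d B -> forall a,
  Ainfty_constant d mu sigma = a%:E ->
  (\int[mu]_(x in B) maximal d mu (fun y => sigma y * (\1_B y)%:E)%E x <=
   a%:E * \int[mu]_(x in B) sigma x)%E.
Proof.
move=> hB a Aa.
have [_ soo] := Aq_integral_lty hB; have s0 := dual_weight_integral_gt0 hB.
have : ((\int[mu]_(x in B) sigma x)^-1 *
   \int[mu]_(x in B) maximal d mu (fun y => sigma y * (\1_B y)%:E)%E x <= a%:E)%E.
  by rewrite -Aa; apply: ereal_sup_ubound; exists B.
move: s0 soo; case: (\int[mu]_(x in B) sigma x)%E => // i; rewrite lte_fin => i0 _.
by rewrite inver gt_eqF// lee_pdivrMl// muleC.
Qed.

End dual_weight.

(** * Openness of the A_p condition *)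

Section open_property.
Context {R : realType} {S : ptopologicalType} (d : S -> S -> R)
  (mu : {measure set (borel S) -> \bar R}) (kappa : R).
Hypothesis hS : homogeneous_type d mu kappa.
Variables (p : R) (w : borel S -> \bar R).
Hypothesis hw : in_Aq d mu p w.
Local Notation D := (doubling_order d mu).

Lemma tau_gt0 : 0 < tau d mu kappa.
Proof.
have k1 : 1 <= kappa by case: (ht_quasimetric hS).
have k2 : 1 <= kappa ^+ 2 by rewrite exprn_ege1.
rewrite mulr_gt0// powR_gt0//; apply: mulr_gt0; first lra.
by apply: exprn_gt0; lra.
Qed.

(** With [r = 1 + 1 / t], the new exponent [q] satisfies [q - 1 = (p - 1) / r], so
    the dual weight for [q] is [sigma `^ r]. The reverse Hoelder inequality bounds
    its average over [B] by that of [sigma] over [2 kappa B]; doubling does the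
    same for [w] at the cost of [(4 kappa) `^ D]. *)
Lemma Aq_constant_open a : Ainfty_constant d mu (fun x => epow (w x) (- (p - 1)^-1)) = a%:E ->
  (Aq_constant d mu (p - (p - 1) / (1 + tau d mu kappa * a)) w <=
    (2 `^ (p - 1) * (4 * kappa) `^ (p * D))%:E * Aq_constant d mu p w)%E.
Proof.
move=> Aa; pose t := tau d mu kappa * a.
have p1 : 1 < p by case: hw.
have k1 : 1 <= kappa by case: (ht_quasimetric hS).
have D0 := doubling_order_ge0 hS.
have [_ [mw w0] _] := hw.
have a1 : 1 <= a by rewrite -lee_fin -Aa; exact: (Ainfty_dual_ge1 hS hw).
have t0 : 0 < t by rewrite mulr_gt0 ?tau_gt0//; lra.
rewrite -/t; set q := p - _; pose r := 1 + t^-1.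
have t1 : t^-1 > 0 by rewrite invr_gt0.
have r0 : 0 < r by rewrite /r; lra.
have qr : q - 1 = (p - 1) / r.
  by rewrite /q /r; field; rewrite !gt_eqF//=; lra.
have q1 : 0 < q - 1 by rewrite qr divr_gt0//; lra.
pose sigma x := epow (w x) (- (p - 1)^-1).
have sE x : epow (w x) (- (q - 1)^-1) = (sigma x * sigma x `^ t^-1)%E.
  have -> : - (q - 1)^-1 = - (p - 1)^-1 * r.
    by rewrite qr; field; rewrite ?gt_eqF//; lra.
  rewrite epowM//; last by rewrite oppr_lt0 invr_gt0; lra.
  rewrite /r poweRD ?poweRe1 ?epow_ge0//.
  by apply/implyP => /eqP; lra.
have s0 x : (0 <= sigma x)%E by exact: epow_ge0.
have ms : measurable_fun [set: borel S] sigma by exact: (dual_weight_measurable hw).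
have sfin B : qballs d B -> (0 < \int[mu]_(x in B) sigma x < +oo)%E.
  move=> hB; rewrite (dual_weight_integral_gt0 hS hw hB) /=.
  by have [] := Aq_integral_lty hS hw hB.
set K := (4 * kappa) `^ D.
have K1 : 1 <= K.
  have : 1 `^ D <= K by apply: ge0_ler_powR; rewrite ?nnegrE//; lra.
  by rewrite powR1.
have KE : 2 `^ (p - 1) * (4 * kappa) `^ (p * D) = K * (2 * K) `^ (p - 1).
  have -> : (4 * kappa) `^ (p * D) = K * K `^ (p - 1).
    by rewrite (mulrC p) powRrM -/K mulr_powRB1//; lra.
  by rewrite powRM//; [ring|lra].
have ATe : 6 * (a * (32 * kappa ^+ 2 * (4 * kappa ^+ 2 + kappa) ^+ 2) `^ D) * t^-1 <= 1.
  have -> : 6 * (a * (32 * kappa ^+ 2 * (4 * kappa ^+ 2 + kappa) ^+ 2) `^ D) = t.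
    by rewrite /t /tau; ring.
  by rewrite divff// gt_eqF.
apply: ge_ereal_sup => _ [_ [x [rho [rho0 ->]]] <-].
set B := qball d x rho; pose hB := qball d x (2 * kappa * rho).
have qB : qballs d B by exact: qballs_qball.
have qhB : qballs d hB by apply: qballs_qball; rewrite !mulr_gt0//; lra.
have [wB _] := Aq_integral_lty hS hw qB.
have [whB shB] := Aq_integral_lty hS hw qhB.
pose aw := fine (avg mu hB w); pose as_ := fine (avg mu hB sigma).
have aw0 : 0 <= aw by rewrite fine_ge0// avg_ge0.
have as0 : 0 <= as_ by rewrite fine_ge0// avg_ge0.
have awE : avg mu hB w = aw%:E by rewrite fineK// (avg_fin_num hS).
have asE : avg mu hB sigma = as_%:E by rewrite fineK// (avg_fin_num hS).
have hAq : ((aw * as_ `^ (p - 1))%:E <= Aq_constant d mu p w)%E.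
  apply: ereal_sup_ubound; exists hB => //.
  by rewrite -/sigma awE asE.
have leB : B `<=` hB.
  by apply: le_qball; have : 1 * rho <= kappa * rho; [rewrite ler_pM2r|lra].
have Bw : (avg mu B w <= (K * aw)%:E)%E.
  rewrite (avg_leE hS)//.
  apply: (@le_trans _ _ (\int[mu]_(x in hB) w x)%E).
    apply: ge0_subset_integral => //; try exact: (measurable_qballs hS).
    exact: measurable_funTS.
  rewrite (integral_avg hS qhB w0 whB) -/aw mulrC EFinM -muleA.
  apply: lee_wpmul2l => //.
  apply: le_trans (mu_qball_scale hS _ rho0 _) _; first lra.
  by rewrite /K (_ : 2 * (2 * kappa) = 4 * kappa)//; ring.
have Bs : (avg mu B (fun x => epow (w x) (- (q - 1)^-1)) <=
    ((2 * K * as_) `^ r)%:E)%E.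
  rewrite (avg_leE hS)//; under eq_integral do rewrite sE.
  apply: (reverse_hoelder hS ms s0 sfin a1 _ x rho0 (ltW t1) ATe).
  by move=> V hV; exact: (Ainfty_dual_le hS hw hV Aa).
have Bs' : (avg mu B (fun x => epow (w x) (- (q - 1)^-1)) `^ (q - 1) <=
    ((2 * K) `^ (p - 1) * as_ `^ (p - 1))%:E)%E.
  apply: (@le_trans _ _ ((((2 * K * as_) `^ r)%:E) `^ (q - 1))%E).
    apply: gt0_ler_poweR => //; rewrite ?ltW//.
    - by rewrite in_itv/= leey andbT avg_ge0// => y; exact: epow_ge0.
    - by rewrite in_itv/= leey andbT lee_fin powR_ge0.
  rewrite poweR_EFin -powRrM qr mulrCA divff ?gt_eqF// mulr1 powRM//.
  by rewrite mulr_ge0//; lra.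
rewrite /mule_infty ifF; last first.
  apply/negP => /orP[/eqP Boo|/eqP Boo].
    by move: Bw; rewrite Boo.
  by move: Bs'; rewrite Boo.
apply: (@le_trans _ _ ((K * aw)%:E * ((2 * K) `^ (p - 1) * as_ `^ (p - 1))%:E)%E).
  apply: lee_pmul => //; last exact: poweR_ge0.
  by apply: avg_ge0.
rewrite KE; apply: (@le_trans _ _ ((K * (2 * K) `^ (p - 1))%:E * (aw * as_ `^ (p - 1))%:E)%E).
  by rewrite -!EFinM lee_fin le_eqVlt; apply/orP; left; apply/eqP; ring.
apply: lee_wpmul2l => //.
by rewrite lee_fin mulr_ge0 ?powR_ge0.
Qed.

End open_property.

Theorem theorem1p2 (R : realType) (S : ptopologicalType) (d : S -> S -> R)
    (mu : {measure set (borel S) -> \bar R}) (kappa : R)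
    (hS : homogeneous_type d mu kappa)
    (p p' : R) (hp : 1 < p) (hp' : p^-1 + p'^-1 = 1)
    (w : borel S -> \bar R) (hw : in_Aq d mu p w) :
  let sigma := fun x => epow (w x) (1 - p') in
  exists eps : R,
    [/\ eps%:E =
          ((p - 1)%:E / hoelder_conjugate (rh_exponent d mu kappa sigma))%E,
        eps%:E =
          ((p - 1)%:E / (1 + (tau d mu kappa)%:E * Ainfty_constant d mu sigma))%E,
        in_Aq d mu (p - eps) w &
        (Aq_constant d mu (p - eps) w <=
          (2 `^ (p - 1) * (4 * kappa) `^ (p * doubling_order d mu))%:E *
          Aq_constant d mu p w)%E].
Proof.
have k1 : 1 <= kappa by case: (ht_quasimetric hS).
have D0 := doubling_order_ge0 hS.
have p'E : 1 - p' = - (p - 1)^-1.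
  have p'V : p'^-1 = (p - 1) / p.
    by rewrite -[LHS](addKr p^-1) hp'; field; rewrite gt_eqF//; lra.
  by rewrite -[p']invrK p'V; field; rewrite !gt_eqF//; lra.
rewrite p'E => sigma.
have tau0 := tau_gt0 hS.
have A1 : (1 <= Ainfty_constant d mu sigma)%E := Ainfty_dual_ge1 hS hw.
have [_ [mw w0] Aoo] := hw.
case AE : (Ainfty_constant d mu sigma) A1 => [a| |] //; rewrite ?lee_fin => a1; last first.
  (* Infinite [A_infty] constant: [eps = 0], and the factor is at least 1. *)
  exists 0; rewrite subr0 /rh_exponent AE gt0_muley ?lte_fin// invey adde0.
  rewrite hoelder_conjugate1 invey mule0; split => //.
  have Aq0 : (0 <= Aq_constant d mu p w)%E.
    have hB : qballs d (qball d point 1) by exact: qballs_qball.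
    apply: le_trans (ereal_sup_ubound _); last by exists (qball d point 1).
    rewrite /mule_infty; case: ifP => // _; rewrite mule_ge0 ?poweR_ge0//.
    exact: avg_ge0.
  rewrite -[leLHS]mul1e; apply: lee_wpmul2r => //; rewrite lee_fin mulr_ege1//.
    have : 1 `^ (p - 1) <= 2 `^ (p - 1) by apply: ge0_ler_powR; rewrite ?nnegrE//; lra.
    by rewrite powR1.
  have : 1 `^ (p * doubling_order d mu) <= (4 * kappa) `^ (p * doubling_order d mu).
    apply: ge0_ler_powR; rewrite ?nnegrE//; try lra.
    by rewrite mulr_ge0//; lra.
  by rewrite powR1.
pose t := tau d mu kappa * a.
have t0 : 0 < t by rewrite mulr_gt0//; lra.
have tV0 : 0 < t^-1 by rewrite invr_gt0.
have bound := Aq_constant_open hS hw AE.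
exists ((p - 1) / (1 + t)); split => //.
- rewrite /rh_exponent AE -EFinM -/t inver gt_eqF// -EFinD /hoelder_conjugate/=.
  rewrite eqe gt_eqF; last by lra.
  rewrite -EFinB inver gt_eqF; last by lra.
  rewrite -EFinM inver gt_eqF; last by rewrite divr_gt0//; lra.
  by rewrite -EFinM; congr EFin; field; rewrite ?gt_eqF//; lra.
- rewrite -EFinM -/t -EFinD inver gt_eqF; last by lra.
  by rewrite -EFinM.
split => //.
  have : (p - 1) / (1 + t) < p - 1.
    by rewrite ltr_pdivrMr ?ltr_pMr; lra.
  lra.
apply: le_lt_trans bound _; rewrite lte_mul_pinfty//.
by rewrite lee_fin mulr_ge0 ?powR_ge0.
Qed.
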